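(* Let $\phi=\tilde p/p$ be a rational inner function on $\mathbb{D}^2$ with $\deg\phi=(m,n)$, and assume $N_{\mathbb{T}^2}(\tilde p,p)=2mn$ (with $mn\ge1$). Then at least one of $\frac{\partial\phi}{\partial z_1}$, $\frac{\partial\phi}{\partial z_2}$ is not in $H^2(\mathbb{D}^2)$.
   Context: $\phi=\tilde p/p$ where $p\in\mathbb{C}[z_1,z_2]$ has bidegree $(m,n)$, no zeros in $\mathbb{D}^2$, is atoral (no common factor with $\tilde p$), and $\tilde p(z)=z_1^mz_2^n\overline{p(1/\bar z_1,1/\bar z_2)}$. $N_{\mathbb{T}^2}(\tilde p,p)$ is the sum, over common zeros $\lambda\in\mathbb{T}^2$ of $p$ and $\tilde p$, of the intersection multiplicities $N_\lambda(p,\tilde p)$ of the algebraic curves $\{p=0\}$ and $\{\tilde p=0\}$; by Bézout it is at most $2mn$. $H^2(\mathbb{D}^2)$: holomorphic $f$ with $\sup_{0<r<1}\frac1{4\pi^2}\int_{\mathbb{T}^2}|f(r\zeta)|^2|d\zeta|<\infty$. *)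

(* Defs.v *)
From HB Require Import structures.
From mathcomp Require Import all_boot all_order all_algebra.
From mathcomp Require Import all_classical all_reals all_analysis.
From mathcomp.real_closed Require Import complex.
Set Implicit Arguments. Unset Strict Implicit. Unset Printing Implicit Defensive.
Import Order.TTheory GRing.Theory Num.Theory.
Local Open Scope ring_scope.

Section TwoVarPolys.
Variable R : realType.
Local Notation C := R[i].

(* Polynomials in two variables z1, z2 are encoded as {poly {poly C}}:
   P = \sum_j P_j(z1) z2^j, i.e. the outer variable is z2, the inner is z1. *)
Definition eval2 (P : {poly {poly C}}) (z1 z2 : C) : C := (P.[z2%:P]).[z1].

Definition deg_z1 (P : {poly {poly C}}) : nat := (\max_(j < size P) size (nth 0%R P j))%N.-1.
Definition deg_z2 (P : {poly {poly C}}) : nat := (size P).-1.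

Definition has_bidegree (P : {poly {poly C}}) (m n : nat) : Prop :=
  P != 0 /\ deg_z1 P = m /\ deg_z2 P = n.

Definition const2 (c : C) : {poly {poly C}} := c%:P%:P.

Definition common_factor (p q : {poly {poly C}}) : Prop :=
  exists r a b : {poly {poly C}},
    (forall c : C, r != const2 c) /\ p = r * a /\ q = r * b.

Definition dz1 (P : {poly {poly C}}) : {poly {poly C}} := map_poly deriv P.
Definition dz2 (P : {poly {poly C}}) : {poly {poly C}} := deriv P.

(* ---- intersection multiplicity (Fulton): I_lam(p,q) = dim_C O_lam/(p,q)O_lam,
   computed as dim_C A/L with A = C[z1,z2] and
   L = A \cap (p,q)O_lam = { f | exists h, h(lam) <> 0, h f \in (p,q) }. *)
Definition loc_ideal (p q : {poly {poly C}}) (l1 l2 : C) (f : {poly {poly C}}) : Prop :=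
  exists h a b : {poly {poly C}}, eval2 h l1 l2 != 0 /\ h * f = a * p + b * q.

Definition quot_dim (L : {poly {poly C}} -> Prop) (d : nat) : Prop :=
  exists f : 'I_d -> {poly {poly C}},
    (forall c : 'I_d -> C,
        L (\sum_(i < d) const2 (c i) * f i) -> forall i, c i = 0) /\
    (forall g, exists c : 'I_d -> C, L (g - \sum_(i < d) const2 (c i) * f i)).

Definition int_mult (p q : {poly {poly C}}) (l1 l2 : C) (d : nat) : Prop :=
  quot_dim (loc_ideal p q l1 l2) d.

Definition on_T2 (l : C * C) : Prop := `|l.1| = 1 /\ `|l.2| = 1.

Definition NT2 (p q : {poly {poly C}}) (N : nat) : Prop :=
  exists (s : seq (C * C)) (mult : C * C -> nat),
    uniq s /\
    (forall l, l \in s <-> (on_T2 l /\ eval2 p l.1 l.2 = 0 /\ eval2 q l.1 l.2 = 0)) /\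
    (forall l, l \in s -> int_mult p q l.1 l.2 (mult l)) /\
    (\sum_(l <- s) mult l)%N = N.

Definition expi (t : R) : C := (cos t +i* sin t)%C.

Definition H2_integral (f : C -> C -> C) (r : R) : \bar R :=
  ((4 * pi ^+ 2)^-1)%:E *
  (\int[lebesgue_measure]_(t1 in `[0%R, (2 * pi)%R]%classic)
     \int[lebesgue_measure]_(t2 in `[0%R, (2 * pi)%R]%classic)
        ((complex.Re (`| f ((r%:C)%C * expi t1) ((r%:C)%C * expi t2) | ^+ 2))%R)%:E)%E.

Definition in_H2_bidisc (f : C -> C -> C) : Prop :=
  exists M : R, forall r : R, 0 < r < 1 -> (H2_integral f r <= M%:E)%E.

End TwoVarPolys.

(* Main.v *)
Require Import Defs.
From HB Require Import structures.
From mathcomp Require Import all_boot all_order all_algebra.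
From mathcomp Require Import all_classical all_reals all_analysis.
From mathcomp.real_closed Require Import complex.
From mathcomp Require Import ring lra zify.
Set Implicit Arguments. Unset Strict Implicit. Unset Printing Implicit Defensive.
Import Order.TTheory GRing.Theory Num.Theory.
Import numFieldNormedType.Exports ComplexField.Normc.
Local Open Scope classical_set_scope.
Local Open Scope ring_scope.

(* Only one common zero (lam1, lam2) of p and ptilde on T^2 and the finiteness of
   the set of such zeros matter; the multiplicities do not.

   Write phi(x, z) = sum_l alpha_l(x) z^l and alpha_l(x) = sum_k a_lk x^k. If both
   partial derivatives are in H^2, then sum_{k,l} (k^2 + l^2) |a_lk|^2 < oo, and
   Cauchy-Schwarz in k gives
     l |alpha_l(x)|^2 <= 4 sum_k (k^2 + l^2) |a_lk|^2   for |x| <= 1.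
   Hence D(x) = sum_l l |alpha_l(x)|^2, the Dirichlet integral of the slice
   phi(x, .), is a uniformly convergent sum of continuous functions, so it is
   continuous on the closed disc. For |x| = 1 the slice is, up to a constant, a
   finite Blaschke product, and D(x) is its number of zeros in the open disc. This
   number is n for x in T near lam1 outside the finite exceptional set, but at most
   n - 1 at x = lam1, where a factor z - lam2 cancels: contradiction. *)

(** The zero count is reached through circle means, without differentiating a Blaschke product. A
    factor [b] with zero at [conjc gam] satisfies [1 - |b|^2 = (1 - |z|^2) |k|^2], where [k] is the
    normalized Szego kernel: it has norm one in H^2 of the disc if [|gam| < 1], and it is zero if
    [|gam| = 1]. So the mean of [1 - |phi|^2] over [|z| = rho], divided by [1 - rho^2], tends to the
    number of zeros in the open disc as rho -> 1. By Parseval the same quotient is a difference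
    quotient of [sum_l |alpha_l|^2 rho^(2l)], and it tends to [D]. Only one-sided estimates with a
    gap between them are proved: at most [n - 1] at [lam1], more than [n - 1/2] at nearby points.
    All functions involved are quotients of polynomials, so their Taylor series come from formal
    division. Convergence in the disc follows by dividing by one linear factor at a time; the root
    of such a factor may lie on the unit circle, which is what happens for the slice at [lam1]. *)

Section StrongRecursion.
Variables (T : Type) (x0 : T) (F : nat -> (nat -> T) -> T).
Hypothesis Fext : forall n f g, (forall i, (i < n)%N -> f i = g i) -> F n f = F n g.

(** Course-of-values recursion made structural: the list of all earlier values is carried along. By
    [Fext] the default [x0] never influences a value. *)
Fixpoint rec_prefix n : seq T :=
  if n is m.+1 then rcons (rec_prefix m) (F m (nth x0 (rec_prefix m))) else [::].

Lemma size_rec_prefix n : size (rec_prefix n) = n.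
Proof. by elim: n => //= n IHn; rewrite size_rcons IHn. Qed.

Lemma nth_rec_prefix n i : (i < n)%N ->
  nth x0 (rec_prefix n) i = F i (nth x0 (rec_prefix i)).
Proof.
elim: n => // n IHn; rewrite ltnS leq_eqVlt => /orP[/eqP ->|ltin] /=.
  by rewrite nth_rcons size_rec_prefix ltnn eqxx.
by rewrite nth_rcons size_rec_prefix ltin IHn.
Qed.

Lemma strong_recursion : exists f : nat -> T, forall n, f n = F n f.
Proof.
exists (fun n => nth x0 (rec_prefix n.+1) n) => n.
rewrite nth_rec_prefix //; apply: Fext => i ltin.
by rewrite !nth_rec_prefix.
Qed.

End StrongRecursion.

(* Polynomials act on formal power series by Cauchy product, so double series are
   ser (ser V), acted upon by {poly {poly K}}. *)
Definition ser (V : Type) := nat -> V.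

HB.instance Definition _ (V : zmodType) := GRing.Zmodule.copy (ser V) (nat -> V).


(** Regroups the triangle i + j <= n by k = i + j; this is associativity of the Cauchy product. *)
Lemma triangular_exchange (V : zmodType) (G : nat -> nat -> V) n :
  \sum_(i < n.+1) \sum_(j < (n - i).+1) G i j =
  \sum_(k < n.+1) \sum_(j < k.+1) G j (k - j)%N.
Proof.
elim: n => [|n IHn]; first by rewrite !big_ord1.
rewrite [RHS]big_ord_recr /= -IHn [LHS]big_ord_recr /=.
rewrite [X in _ = _ + X]big_ord_recr /= !subnn big_ord1 addrA; congr (_ + _).
rewrite -big_split; apply: eq_bigr => i _ /=.
by rewrite subSn ?leq_ord // big_ord_recr.
Qed.

(** * Formal power series as modules over polynomials *)

Section SerModule.
Variables (K : comNzRingType) (V : lmodType K).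

Definition ser_scale (P : {poly K}) (b : ser V) : ser V :=
  fun n => \sum_(i < n.+1) P`_i *: b (n - i)%N.

Lemma ser_scaleA P Q b : ser_scale P (ser_scale Q b) = ser_scale (P * Q) b.
Proof.
apply/funext => n; rewrite /ser_scale.
under eq_bigr => i _ do rewrite scaler_sumr.
under [RHS]eq_bigr => i _ do rewrite coefM scaler_suml.
transitivity (\sum_(i < n.+1) \sum_(j < (n - i).+1)
    (P`_i * Q`_j) *: b (n - (i + j))%N).
  by apply: eq_bigr => i _; apply: eq_bigr => j _; rewrite scalerA subnDA.
rewrite (triangular_exchange (fun i j => (P`_i * Q`_j) *: b (n - (i + j))%N)).
by apply: eq_bigr => k _; apply: eq_bigr => j _; rewrite subnKC // -ltnS.
Qed.

Lemma ser_scale1 : left_id 1 ser_scale.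
Proof.
move=> b; apply/funext => n; rewrite /ser_scale big_ord_recl coef1 scale1r subn0.
by rewrite big1 ?addr0 // => i _; rewrite coef1 scale0r.
Qed.

Lemma ser_scaleDr : right_distributive ser_scale +%R.
Proof.
move=> P b c; apply/funext => n.
rewrite [RHS](_ : _ = ser_scale P b n + ser_scale P c n) // /ser_scale -big_split.
by apply: eq_bigr => i _ /=; rewrite -scalerDr.
Qed.

Lemma ser_scaleDl b : {morph ser_scale^~ b : P Q / P + Q}.
Proof.
move=> P Q; apply/funext => n.
rewrite [RHS](_ : _ = ser_scale P b n + ser_scale Q b n) // /ser_scale -big_split.
by apply: eq_bigr => i _ /=; rewrite -scalerDl coefD.
Qed.

End SerModule.

HB.instance Definition _ (K : comNzRingType) (V : lmodType K) :=
  GRing.Zmodule_isLmodule.Build {poly K} (ser V)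
    (@ser_scaleA K V) (@ser_scale1 K V) (@ser_scaleDr K V) (@ser_scaleDl K V).

Section SerTheory.
Variables (K : comNzRingType) (V : lmodType K).
Implicit Types (P : {poly K}) (b : ser V).

Lemma serZE P b n : (P *: b) n = \sum_(i < n.+1) P`_i *: b (n - i)%N.
Proof. by []. Qed.

Lemma serDE b c n : (b + c) n = b n + c n. Proof. by []. Qed.

Lemma serMnE b m n : (b *+ m) n = b n *+ m.
Proof. by elim: m => [|m IHm] //; rewrite !mulrS serDE IHm. Qed.

Lemma serZ0 P b : (P *: b) 0%N = P`_0 *: b 0%N.
Proof. by rewrite serZE big_ord1. Qed.

Lemma serZ_recl P b n :
  (P *: b) n = P`_0 *: b n + \sum_(i < n) P`_i.+1 *: b (n - i.+1)%N.
Proof. by rewrite serZE big_ord_recl subn0. Qed.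

(** Coefficients are solved for one after the other. The condition on [P]_0[is surjectivity of its
    action, not invertibility: for double series]P[_0] is a polynomial in the inner variable, which
    is rarely a unit but does act surjectively on series once its own constant term is nonzero. The
    lemma is then applied twice. *)
Lemma ser_divisible P : (forall v : V, exists w, P`_0 *: w = v) ->
  forall b, exists c, P *: c = b.
Proof.
move=> P0; have [g gP] := choice P0 => b.
pose F n (f : nat -> V) := g (b n - \sum_(i < n) P`_i.+1 *: f (n - i.+1)%N).
have [|f fE] := @strong_recursion V 0 F.
  move=> n f h fh; congr (g (_ - _)); apply: eq_bigr => i _.
  by rewrite fh // subnSK // leq_subr.
exists f; apply/funext => n; rewrite serZ_recl (fE n) gP.
by rewrite subrK.
Qed.

(** The Euler operator z d/dz. Unlike d/dz it shifts no index, and the extra factor z has modulus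
    below one on the disc, so bounds on the derivative carry over. *)
Definition ser_euler b : ser V := fun n => b n *+ n.

Lemma ser_eulerD b c : ser_euler (b + c) = ser_euler b + ser_euler c.
Proof. by apply/funext => n; rewrite /ser_euler serDE mulrnDl. Qed.

Lemma ser_euler_leibniz P b :
  P *: ser_euler b = ser_euler (P *: b) - ('X * P^`()) *: b.
Proof.
apply/eqP; rewrite -subr_eq opprK; apply/eqP; apply/funext => n.
rewrite serDE !serZE /ser_euler -big_split serZE -sumrMnl; apply: eq_bigr => i _ /=.
have le_in : (i <= n)%N by rewrite -ltnS.
rewrite coefXM; case: i le_in => -[|i] lti /= le_in.
  by rewrite subn0 scale0r addr0 scalerMnr.
by rewrite coef_deriv -scalerMnr -scalerMnl -mulrnDr subnK.
Qed.

End SerTheory.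

Definition ser_of_poly (K : comNzRingType) (P : {poly K}) : ser K^o := fun n => P`_n.

Definition ser2_of_poly (K : comNzRingType) (P : {poly {poly K}}) : ser (ser K^o) :=
  fun n => ser_of_poly P`_n.

Section SerOfPoly.
Variable K : comNzRingType.

Lemma ser_of_polyM (P Q : {poly K}) : ser_of_poly (P * Q) = P *: ser_of_poly Q.
Proof. by apply/funext => n; rewrite serZE /ser_of_poly coefM. Qed.

Lemma ser_of_polyB (P Q : {poly K}) :
  ser_of_poly (P - Q) = ser_of_poly P - ser_of_poly Q.
Proof. by apply/funext => n; rewrite /ser_of_poly coefB. Qed.

Lemma ser_of_poly_sum (I : Type) (r : seq I) (F : I -> {poly K}) :
  ser_of_poly (\sum_(i <- r) F i) = \sum_(i <- r) ser_of_poly (F i).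
Proof.
elim/big_rec2: _ => [|i b Q _ IH]; first by apply/funext => n; rewrite /ser_of_poly coef0.
by rewrite -IH; apply/funext => n; rewrite /ser_of_poly coefD.
Qed.

Lemma ser2_of_polyM (P Q : {poly {poly K}}) :
  ser2_of_poly (P * Q) = P *: ser2_of_poly Q.
Proof.
apply/funext => n; rewrite serZE /ser2_of_poly coefM ser_of_poly_sum.
by apply: eq_bigr => i _; rewrite ser_of_polyM.
Qed.

Lemma ser2_of_polyB (P Q : {poly {poly K}}) :
  ser2_of_poly (P - Q) = ser2_of_poly P - ser2_of_poly Q.
Proof. by apply/funext => n; rewrite /ser2_of_poly coefB ser_of_polyB. Qed.

Lemma ser_euler_of_poly (P : {poly K}) :
  ser_euler (ser_of_poly P) = ser_of_poly ('X * P^`()).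
Proof.
by apply/funext => -[|n]; rewrite /ser_euler /ser_of_poly coefXM //= coef_deriv.
Qed.

Lemma ser2_euler_of_poly (P : {poly {poly K}}) :
  ser_euler (ser2_of_poly P) = ser2_of_poly ('X * P^`()).
Proof.
apply/funext => -[|n]; apply/funext => k; rewrite /ser_euler /ser2_of_poly /ser_of_poly.
  by rewrite coefXM /= coef0.
rewrite coefXM /= coef_deriv coefMn.
by rewrite serMnE.
Qed.

Definition inner_euler (b : ser (ser K^o)) : ser (ser K^o) := fun l => ser_euler (b l).

Lemma inner_euler_leibniz (P : {poly {poly K}}) (b : ser (ser K^o)) :
  P *: inner_euler b =
  inner_euler (P *: b) - ('X%:P * map_poly deriv P) *: b.
Proof.
apply/eqP; rewrite -subr_eq opprK; apply/eqP; apply/funext => l.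
rewrite serDE !serZE /inner_euler -big_split serZE.
have -> (n : nat) (F : 'I_n -> ser K^o) :
    ser_euler (\sum_(i < n) F i) = \sum_(i < n) ser_euler (F i).
  elim/big_rec2: _ => [|i b' c _ <-]; last exact: ser_eulerD.
  by apply/funext => k; rewrite /ser_euler mul0rn.
apply: eq_bigr => i _ /=; rewrite ser_euler_leibniz coefCM coef_map_id0 ?deriv0 //.
by rewrite subrK.
Qed.

Lemma inner_euler_of_poly (P : {poly {poly K}}) :
  inner_euler (ser2_of_poly P) = ser2_of_poly ('X%:P * map_poly deriv P).
Proof.
apply/funext => l; rewrite /inner_euler /ser2_of_poly ser_euler_of_poly.
by rewrite coefCM coef_map_id0 ?deriv0.
Qed.

End SerOfPoly.

(** * The modulus as a real number *)

Section ComplexModulus.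
Variable R : realType.
Implicit Types x y z : R[i].

Lemma normr_normc z : `|z| = (normc z)%:C%C.
Proof. by []. Qed.

Lemma normc_ge0 z : 0 <= normc z.
Proof. by case: z => a b; exact: sqrtr_ge0. Qed.

Lemma normc_eq0 z : (normc z == 0) = (z == 0).
Proof. by apply/eqP/eqP => [/eq0_normc//|->]; exact: normc0. Qed.

Lemma normc_gt0 z : (0 < normc z) = (z != 0).
Proof. by rewrite lt_neqAle eq_sym normc_eq0 normc_ge0 andbT. Qed.

Lemma ler_normcD x y : normc (x + y) <= normc x + normc y.
Proof. exact: le_normcD. Qed.

Lemma normc_opp x : normc (- x) = normc x.
Proof. exact: normcN. Qed.

Lemma normc_distC x y : normc (x - y) = normc (y - x).
Proof. by rewrite -normc_opp opprB. Qed.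

Lemma normcX z n : normc (z ^+ n) = normc z ^+ n.
Proof. by elim: n => [|n IHn]; rewrite ?normc1 // !exprS normcM IHn. Qed.

Lemma ler_normc_sum (I : Type) (r : seq I) (F : I -> R[i]) :
  normc (\sum_(i <- r) F i) <= \sum_(i <- r) normc (F i).
Proof.
elim/big_rec2: _ => [|i b c _ IH]; first by rewrite normc0.
by apply: le_trans (ler_normcD _ _) _; rewrite lerD2l.
Qed.

Lemma normc_real (r : R) : 0 <= r -> normc (r%:C)%C = r.
Proof. by move=> r0; rewrite /= expr0n addr0 sqrtr_sqr ger0_norm. Qed.

Lemma normc_conj z : normc (conjc z) = normc z.
Proof. by case: z => a b /=; rewrite sqrrN. Qed.

Lemma sqr_normcE z : normc z ^+ 2 = complex.Re z ^+ 2 + complex.Im z ^+ 2.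
Proof. by case: z => a b; rewrite sqr_sqrtr // addr_ge0 ?sqr_ge0. Qed.

Lemma sqr_normcC z : ((normc z ^+ 2)%:C)%C = z * conjc z.
Proof. by rewrite -sqr_normc normr_normc -rmorphXn. Qed.

Lemma normr_lt1 z : (`|z| < 1) = (normc z < 1).
Proof. exact: ltcR. Qed.

Lemma normr_eq1 z : `|z| = 1 <-> normc z = 1.
Proof. by rewrite normr_normc; split=> [[]|->]. Qed.

Lemma Re_sqr_normr z : complex.Re (`|z| ^+ 2) = normc z ^+ 2.
Proof. by rewrite normr_normc -rmorphXn. Qed.

Lemma ler_normcB x y : normc x - normc y <= normc (x - y).
Proof. by rewrite lerBlDr -{1}(subrK y x) ler_normcD. Qed.

End ComplexModulus.

(** * Power series converging on the open unit disc *)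

Section ConvergentSeries.
Variable R : realType.
Local Notation C := R[i].
Implicit Types (b c : ser C^o) (F G : C -> C) (rho : R) (D : {poly C}) (x : C).

Definition psum b (n : nat) x : C := \sum_(l < n) (b l : C) * x ^+ l.

(* b is the Taylor series of F on the open unit disc. The geometric bound on
   the coefficients is kept as a separate component, so that no completeness of C
   is ever needed. *)
Definition pser b F := forall rho, 0 < rho < 1 ->
  (exists M, forall l, normc (b l) * rho ^+ l <= M) /\
  (forall eps, 0 < eps -> exists N, forall n, (N <= n)%N -> forall x,
     normc x <= rho -> normc (F x - psum b n x) <= eps).

Lemma geometric_small (q M eps : R) : 0 <= q < 1 -> 0 < eps ->
  exists N, forall n, (N <= n)%N -> M * q ^+ n <= eps.
Proof.
move=> /andP[q0 q1] eps0.
have cv : (fun n => M * q ^+ n) @ \oo --> (M * 0)%R.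
  apply: cvgM; first exact: cvg_cst.
  by apply: cvg_expr; rewrite ger0_norm.
rewrite mulr0 in cv.
have /cvgr0_norm_lt/(_ _ eps0)[N _ HN] := cv.
exists N => n Nn; have /= := HN n Nn.
by move=> /ltW; apply: le_trans; rewrite ler_norm.
Qed.

Lemma eq_pser b F G : (forall x, normc x < 1 -> F x = G x) -> pser b F -> pser b G.
Proof.
move=> FG bF rho rho01; have [bM bU] := bF rho rho01; split=> // eps /bU[N HN].
exists N => n Nn x xr; rewrite -FG; first exact: HN.
by apply: le_lt_trans xr _; case/andP: rho01.
Qed.

Lemma psumD b c n x : psum (b + c) n x = psum b n x + psum c n x.
Proof. by rewrite /psum -big_split; apply: eq_bigr => i _; rewrite serDE mulrDl. Qed.

Lemma pserD b c F G : pser b F -> pser c G -> pser (b + c) (fun x => F x + G x).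
Proof.
move=> bF cG rho rho01; have [[Mb bM] bU] := bF _ rho01.
have [[Mc cM] cU] := cG _ rho01; split.
  exists (Mb + Mc) => l; apply: le_trans (lerD (bM l) (cM l)).
  rewrite -mulrDl ler_wpM2r //; last exact: ler_normcD.
  by rewrite exprn_ge0 // ltW; case/andP: rho01.
move=> eps eps0; have e20 : 0 < eps / 2 by rewrite divr_gt0.
have [N1 H1] := bU _ e20; have [N2 H2] := cU _ e20.
exists (maxn N1 N2) => n; rewrite geq_max => /andP[n1 n2] x xr.
rewrite psumD opprD addrACA (splitr eps).
by apply: le_trans (ler_normcD _ _) _; rewrite lerD ?H1 ?H2.
Qed.

Lemma pser_scaleC (a : C) b F : pser b F -> pser (a%:P *: b) (fun x => a * F x).
Proof.
move=> bF rho rho01; have [[M bM] bU] := bF _ rho01.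
have bE l : (a%:P *: b) l = a * b l.
  rewrite serZ_recl coefC eqxx big1 ?addr0 // => i _.
  by rewrite coefC scale0r.
split.
  exists (normc a * M) => l; rewrite bE normcM -mulrA ler_wpM2l ?normc_ge0 //.
move=> eps eps0; have a1 : 0 < 1 + normc a by rewrite ltr_wpDr ?normc_ge0.
have [N HN] := bU (eps / (1 + normc a)) (divr_gt0 eps0 a1).
exists N => n Nn x xr.
have -> : psum (a%:P *: b) n x = a * psum b n x.
  by rewrite /psum mulr_sumr; apply: eq_bigr => i _; rewrite bE mulrA.
rewrite -mulrBr normcM; apply: le_trans (ler_wpM2l (normc_ge0 a) (HN n Nn x xr)) _.
by rewrite mulrCA ger_pMr // ler_pdivrMr // mul1r lerDr.
Qed.

Lemma serX_E b l : ('X *: b) l = if l is k.+1 then b k else 0.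
Proof.
case: l => [|l]; first by rewrite serZ0 coefX scale0r.
rewrite serZ_recl coefX scale0r add0r big_ord_recl coefX eqxx scale1r subSS subn0.
by rewrite big1 ?addr0 // => i _; rewrite coefX scale0r.
Qed.

Lemma psumX b n x : psum ('X *: b) n.+1 x = x * psum b n x.
Proof.
rewrite /psum big_ord_recl serX_E mul0r add0r mulr_sumr; apply: eq_bigr => i _.
by rewrite serX_E /= exprS mulrCA.
Qed.

Lemma pser_X b F : pser b F -> pser ('X *: b) (fun x => x * F x).
Proof.
move=> bF rho rho01; have [[M bM] bU] := bF _ rho01.
have /andP[rho0 rho1] := rho01; split.
  exists (Num.max 0 M) => -[|l]; rewrite serX_E; first by rewrite normc0 mul0r le_max lexx.
  rewrite exprS mulrCA; apply: le_trans (_ : M <= _); last by rewrite le_max lexx orbT.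
  apply: le_trans (bM l); apply: ler_piMl; last exact: ltW.
  by rewrite mulr_ge0 ?normc_ge0 ?exprn_ge0 // ltW.
move=> eps eps0; have [N HN] := bU _ eps0; exists N.+1 => -[//|n] Nn x xr.
rewrite psumX -mulrBr normcM.
apply: le_trans (_ : 1 * eps <= _); last by rewrite mul1r.
rewrite ler_pM ?normc_ge0 //; last exact: HN.
by apply: le_trans xr _; exact: ltW.
Qed.

Lemma pser0 : pser 0 (fun=> 0).
Proof.
move=> rho rho01; split; first by exists 0 => l; rewrite normc0 mul0r.
move=> eps eps0; exists 0%N => n _ x _; rewrite /psum big1 ?subr0 ?normc0 ?ltW //.
by move=> i _; rewrite mul0r.
Qed.

Lemma pserZ D b F : pser b F -> pser (D *: b) (fun x => D.[x] * F x).
Proof.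
elim/poly_ind: D b F => [|D a IHD] b F bF.
  rewrite scale0r; apply: eq_pser pser0 => x _; by rewrite horner0 mul0r.
rewrite scalerDl -scalerA.
have := pserD (IHD _ _ (pser_X bF)) (pser_scaleC a bF); apply: eq_pser => x _.
by rewrite hornerD hornerMX hornerC mulrDl mulrA.
Qed.

Lemma pserB b c F G : pser b F -> pser c G -> pser (b - c) (fun x => F x - G x).
Proof.
move=> bF cG; have := pserD bF (pserZ (-1)%:P cG).
rewrite polyCN scaleNr scale1r; apply: eq_pser => x _.
by rewrite hornerN hornerC mulN1r.
Qed.

Lemma pser_sum (I : Type) (r : seq I) (b : I -> ser C^o) (F : I -> C -> C) :
  (forall i, pser (b i) (F i)) ->
  pser (\sum_(i <- r) b i) (fun x => \sum_(i <- r) F i x).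
Proof.
move=> bF; elim: r => [|i r IHr].
  by rewrite big_nil; apply: eq_pser pser0 => x _; rewrite big_nil.
rewrite big_cons; apply: eq_pser (pserD (bF i) IHr) => x _.
by rewrite big_cons.
Qed.

Lemma pser_one : pser (ser_of_poly 1) (fun=> 1).
Proof.
move=> rho /andP[rho0 rho1]; split.
  exists 1 => l; rewrite /ser_of_poly coef1; case: l => [|l]; rewrite ?normc1 ?expr0 ?mulr1 //.
  by rewrite normc0 mul0r.
move=> eps eps0; exists 1%N => -[//|n] _ x _.
rewrite /psum big_ord_recl /ser_of_poly coef1 expr0 mulr1 big1 ?addr0 ?subrr ?normc0 ?ltW //.
by move=> i _; rewrite coef1 mul0r.
Qed.

Lemma pser_of_poly D : pser (ser_of_poly D) (fun x => D.[x]).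
Proof.
rewrite -[D in ser_of_poly D]mulr1 ser_of_polyM.
by apply: eq_pser (pserZ D pser_one) => x _; rewrite mulr1.
Qed.

(** With c = (X - beta) b one has b_(k-1) - beta b_k = c_k, so |beta| >= 1 gives |b_k| <= |b_(k-1)|
    + |c_k| and the coefficients grow slower than any rho^(-k). Multiplying a partial sum of b by x
    - beta telescopes to a partial sum of c up to one boundary term, which controls the
    remainder. *)
Lemma pser_div_linear (beta : C) b G : 1 <= normc beta ->
  pser (('X - beta%:P) *: b) G -> pser b (fun x => G x / (x - beta)).
Proof.
move=> beta1 cG.
have beta0 : beta != 0 by rewrite -normc_gt0 (lt_le_trans ltr01).
set c := ('X - beta%:P) *: b in cG.
have psumc n x : psum c n.+1 x = (x - beta) * psum b n.+1 x - (b n : C) * x ^+ n.+1.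
  rewrite /c scalerBl -scaleN1r -polyC1 -polyCN scalerA -polyCM mulN1r psumD psumX.
  have -> : psum ((- beta)%:P *: b) n.+1 x = - beta * psum b n.+1 x.
    rewrite /psum mulr_sumr; apply: eq_bigr => i _.
    rewrite serZ_recl coefC eqxx big1 ?addr0 1?mulrA // => j _.
    by rewrite coefC scale0r.
  rewrite {2 3}/psum big_ord_recr /= -/(psum b n x) exprS; ring.
have cE l : c l = (if l is k.+1 then (b k : C) else 0) - beta * b l.
  rewrite /c scalerBl [LHS](_ : _ = ('X *: b) l - (beta%:P *: b) l) // serX_E.
  congr (_ - _); rewrite serZ_recl coefC eqxx big1 ?addr0 // => j _.
  by rewrite coefC scale0r.
have bnd rho : 0 < rho < 1 -> exists M, forall l, normc (b l) * rho ^+ l <= M.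
  move=> rho01; have [[M cM] _] := cG _ rho01; have /andP[rho0 rho1] := rho01.
  have M0 : 0 <= M by apply: le_trans (cM 0%N); rewrite mulr_ge0 ?normc_ge0.
  (* The fixed point of t = rho t + M, so the induction closes. *)
  exists (M / (1 - rho)) => l.
  have r1 : 0 < 1 - rho by rewrite subr_gt0.
  elim: l => [|l IHl].
    rewrite expr0 mulr1; apply: le_trans (_ : M <= _); last first.
      by rewrite ler_pdivlMr // ler_piMr // gerBl ltW.
    have := cM 0%N; rewrite expr0 mulr1 cE sub0r normc_opp normcM.
    by apply: le_trans; rewrite ler_peMl ?normc_ge0.
  have le1 : normc (b l.+1) <= normc (b l) + normc (c l.+1).
    rewrite cE -[X in _ <= _ + X]normc_distC; apply: le_trans (_ : normc (beta * b l.+1) <= _).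
      by rewrite normcM ler_peMl ?normc_ge0.
    rewrite -{1}[beta * _](subrK (b l : C)) addrC.
    exact: ler_normcD.
  have rl : 0 <= rho ^+ l.+1 by rewrite exprn_ge0 // ltW.
  have le2 := ler_wpM2r rl le1; apply: (le_trans le2); rewrite mulrDl.
  have -> : M / (1 - rho) = rho * (M / (1 - rho)) + M by field; lra.
  by rewrite lerD ?cM // exprS mulrCA ler_wpM2l // ltW.
move=> rho rho01; split; first exact: bnd.
have /andP[rho0 rho1] := rho01; have [_ cU] := cG _ rho01.
move=> eps eps0; have r1 : 0 < 1 - rho by rewrite subr_gt0.
(* A radius strictly between rho and 1: a bound on b_n sg^n makes b_n rho^n decay like (rho /
   sg)^n. *)
pose sg := (1 + rho) / 2.
have sg01 : 0 < sg < 1 by rewrite /sg; lra.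
have [M bM] := bnd _ sg01.
have e0 : 0 < eps * (1 - rho) / 2 by rewrite divr_gt0 // mulr_gt0.
have sg0 : 0 < sg by case/andP: sg01.
have q01 : 0 <= rho / sg < 1.
  by rewrite divr_ge0 ?ltW //= ltr_pdivrMr // mul1r /sg; lra.
have [N1 H1] := cU _ e0; have [N2 H2] := geometric_small M q01 e0.
exists (maxn N1 N2).+1 => -[//|n]; rewrite ltnS geq_max => /andP[n1 n2] x xr.
have xb : 1 - rho <= normc (x - beta).
  rewrite normc_distC; apply: le_trans (ler_normcB _ _); lra.
have xb0 : x - beta != 0 by rewrite -normc_gt0; lra.
have -> : G x / (x - beta) - psum b n.+1 x =
    ((G x - psum c n.+1 x) - (b n : C) * x ^+ n.+1) / (x - beta).
  by rewrite psumc; field.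
rewrite normcM normcV ler_pdivrMr; last by rewrite normc_gt0.
apply: le_trans (_ : eps * (1 - rho) <= _); last by rewrite ler_pM2l.
apply: le_trans (ler_normcD _ _) _; rewrite normc_opp.
rewrite (splitr (eps * (1 - rho))) lerD //; first by apply: H1 => //; exact: leqW.
apply: le_trans (H2 n n2); rewrite normcM normcX.
have xr1 : normc x <= 1 by lra.
apply: le_trans (_ : normc (b n) * rho ^+ n <= _).
  rewrite ler_wpM2l ?normc_ge0 // exprSr -[leRHS]mulr1.
  by rewrite ler_pM ?exprn_ge0 ?normc_ge0 // lerXn2r ?nnegrE ?normc_ge0 // ltW.
rewrite expr_div_n mulrA ler_pdivlMr ?exprn_gt0 // mulrAC ler_wpM2r //.
by rewrite exprn_ge0 // ltW.
Qed.

(** [D] splits into linear factors, and a polynomial without zeros in the open disc has all its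
    roots at modulus at least one. *)
Lemma pser_div D b G : (forall z, normc z < 1 -> D.[z] != 0) ->
  pser (D *: b) G -> pser b (fun x => G x / D.[x]).
Proof.
have [r DE] := closed_field_poly_normal D.
move: (lead_coef D) DE => a -> {D}.
elim: r b G => [|beta r IHr] b G Dnz.
  rewrite big_nil; rewrite big_nil in Dnz.
  have a0 : a != 0.
    by have := Dnz 0; rewrite normc0 ltr01 hornerZ hornerC mulr1; apply.
  move=> /(pser_scaleC a^-1); rewrite scalerA -polyC1 -mul_polyC -!polyCM mulr1 mulVf //.
  by rewrite scale1r; apply: eq_pser => x _; rewrite hornerC mulrC.
rewrite big_cons [X in X *: b](_ : _ =
   (a *: \prod_(z <- r) ('X - z%:P)) * ('X - beta%:P)); last first.
  by rewrite -scalerAl [X in a *: X = _]mulrC.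
have Dnz' z : normc z < 1 ->
    (a *: \prod_(z <- r) ('X - z%:P)).[z] != 0 /\ z - beta != 0.
  move=> /Dnz; rewrite big_cons !hornerZ hornerM hornerXsubC !mulf_eq0 !negb_or.
  by case/and3P => -> -> ->.
rewrite -scalerA => /IHr H.
have beta1 : 1 <= normc beta.
  by rewrite leNgt; apply/negP => /Dnz'[_]; rewrite subrr eqxx.
have := pser_div_linear beta1 (H (fun z zlt => (Dnz' z zlt).1)).
apply: eq_pser => x _; rewrite !hornerZ hornerM hornerXsubC.
by rewrite -mulrA -invfM; congr (_ * _^-1); ring.
Qed.

Definition slice (P : {poly {poly C}}) x : {poly C} := map_poly (horner_eval x) P.

Lemma horner_slice P x z : (slice P x).[z] = eval2 P x z.
Proof.
have := horner_map (horner_eval x) P z%:P.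
by rewrite /eval2 /= /horner_eval hornerC.
Qed.

Lemma coef_slice P x l : (slice P x)`_l = (P`_l).[x].
Proof. by rewrite coef_map_id0 // /horner_eval horner0. Qed.

Lemma double_pser (P q : {poly {poly C}}) (B : ser (ser C^o)) (alpha : C -> ser C^o) :
  (forall x, normc x < 1 -> (P`_0).[x] != 0) ->
  P *: B = ser2_of_poly q ->
  (forall x, normc x < 1 -> slice P x *: alpha x = ser_of_poly (slice q x)) ->
  forall l, pser (B l) (fun x => alpha x l).
Proof.
move=> P0 PB Pa l; have [m] := ubnP l; elim: m l => // m IHm l lem.
have P0B : P`_0 *: B l = ser_of_poly q`_l - \sum_(i < l) P`_i.+1 *: B (l - i.+1)%N.
  have := congr1 (fun s : ser (ser C^o) => s l) PB; rewrite serZ_recl /ser2_of_poly => <-.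
  by rewrite addrK.
have IH (i : 'I_l) : pser (P`_i.+1 *: B (l - i.+1)%N)
    (fun x => (P`_i.+1).[x] * (alpha x (l - i.+1)%N : C)).
  by apply: pserZ; apply: IHm; have := ltn_ord i; lia.
have := pserB (pser_of_poly q`_l) (pser_sum (index_enum _) IH).
rewrite -P0B => /(pser_div P0); apply: eq_pser => x x1.
have := congr1 (fun s : ser C^o => s l) (Pa x x1); rewrite serZ_recl.
rewrite /ser_of_poly !coef_slice => <-.
rewrite (eq_bigr (fun i : 'I_l => (P`_i.+1).[x] * (alpha x (l - i.+1)%N : C))).
  by rewrite addrK mulrC mulKf // P0.
by move=> i _; rewrite coef_slice.
Qed.

End ConvergentSeries.

(** * Integrals over the circle *)

Section CircleMeans.
Variable R : realType.
Local Notation C := R[i].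
Implicit Types (f g : R -> R) (t : R).

Lemma expiD (s t : R) : expi (s + t) = expi s * expi t.
Proof. by rewrite /expi sinD cosD; simpc; congr (_ +i* _)%C; ring. Qed.

Lemma expi0 : expi (0 : R) = 1.
Proof. by rewrite /expi sin0 cos0. Qed.

Lemma expi_2pi : expi (2 * pi : R) = 1.
Proof. by rewrite mulr_natl /expi sin2pi cos2pi. Qed.

Lemma expiMn t k : expi (k%:R * t) = expi t ^+ k.
Proof.
elim: k => [|k IHk]; first by rewrite mul0r expi0.
by rewrite mulrSr mulrDl mul1r expiD IHk exprSr.
Qed.

Lemma normc_expi t : normc (expi t) = 1.
Proof. by rewrite /= cos2Dsin2 sqrtr1. Qed.

(** The integral is given by an antiderivative: estimates of means then follow from the mean value
    theorem, and the Lebesgue integral enters only in [circle_integral_le_integral]. *)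
Definition circle_integral f (c : R) :=
  continuous f /\ exists2 F : R -> R, (forall t, is_derive t 1 F (f t)) &
    F (2 * pi) - F 0 = c.

Lemma circle_integralD f g c d : circle_integral f c -> circle_integral g d ->
  circle_integral (fun t => f t + g t) (c + d).
Proof.
move=> [cf [F dF Fc]] [cg [G dG Gd]]; split.
  by move=> t; apply: cvgD; [exact: cf|exact: cg].
exists (F + G) => [t|]; first exact: is_deriveD.
by rewrite -Fc -Gd !fctE; ring.
Qed.

Lemma circle_integral_cst (c : R) : circle_integral (fun=> c) (2 * pi * c).
Proof.
split; first by move=> t; exact: cvg_cst.
exists (c \*: id) => [t|].
  by have := is_deriveZ c (is_derive_id t 1); rewrite [c *: 1]mulr1.
by rewrite /= [_ *: 0]mulr0 subr0 [_ *: _]mulrC.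
Qed.

Lemma circle_integral_sum (I : Type) (r : seq I) (f : I -> R -> R) (c : I -> R) :
  (forall i, circle_integral (f i) (c i)) ->
  circle_integral (fun t => \sum_(i <- r) f i t) (\sum_(i <- r) c i).
Proof.
move=> fc; elim: r => [|i r IHr].
  have := circle_integral_cst 0; rewrite mulr0 big_nil.
  by under [X in _ -> circle_integral X _]eq_fun do rewrite big_nil.
rewrite big_cons; under [X in circle_integral X _]eq_fun do rewrite big_cons.
exact: circle_integralD.
Qed.

Lemma circle_integral_expi (w : C) (k : nat) :
  circle_integral (fun t => complex.Re (w * expi t ^+ k.+1)) 0.
Proof.
case: w => u v; set K : R := k.+1%:R.
have K0 : K != 0 by rewrite pnatr_eq0.
have fE : (fun t => complex.Re ((u +i* v)%C * expi t ^+ k.+1)) =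
    (fun t => u * cos (K * t) - v * sin (K * t)).
  by apply/funext => t; rewrite -expiMn /expi; simpc.
have dK (h dh : R -> R) t : is_derive (K * t) 1 h (dh (K * t)) ->
    is_derive t 1 (fun s => h (K * s)) (dh (K * t) * K).
  move=> hd; have dk : is_derive t 1 (K \*: id) K.
    by have := is_deriveZ K (is_derive_id t 1); rewrite [K *: 1]mulr1.
  exact: (@is_derive1_comp _ h (K \*: id)).
have cK (h : R -> R) : continuous h -> continuous (fun s => h (K * s)).
  move=> ch s; apply: (@continuous_comp _ _ _ (fun s => K * s) h); last exact: ch.
  by apply: cvgM; [exact: cvg_cst|exact: cvg_id].
rewrite fE; split.
  move=> t; apply: cvgB; apply: cvgM; try exact: cvg_cst.
    exact: (cK _ (@continuous_cos R)).
  exact: (cK _ (@continuous_sin R)).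
exists ((u / K) \*: (fun s => sin (K * s)) + (v / K) \*: (fun s => cos (K * s))).
  move=> t.
  have d1 := is_deriveZ (u / K) (dK sin cos t (is_derive_sin _)).
  have d2 := is_deriveZ (v / K) (dK cos (fun x => - sin x) t (is_derive_cos _)).
  by apply: is_derive_eq (is_deriveD d1 d2) _; rewrite /GRing.scale /=; field.
have E : expi (K * (2 * pi)) = expi (K * 0).
  by rewrite /K !(expiMn _ k.+1) expi_2pi expi0.
have [E1 E2] : cos (K * (2 * pi)) = cos (K * 0) /\ sin (K * (2 * pi)) = sin (K * 0).
  by case: E.
change (u / K * sin (K * (2 * pi)) + v / K * cos (K * (2 * pi)) -
  (u / K * sin (K * 0) + v / K * cos (K * 0)) = 0).
by rewrite E1 E2 subrr.
Qed.

Lemma circle_integral_sq (b : nat -> C) n :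
  circle_integral (fun t => normc (\sum_(l < n) b l * expi t ^+ l) ^+ 2)
    (2 * pi * \sum_(l < n) normc (b l) ^+ 2).
Proof.
elim: n => [|n IHn].
  rewrite big_ord0 mulr0; under [X in circle_integral X _]eq_fun do rewrite big_ord0 normc0 expr0n.
  by have := circle_integral_cst 0; rewrite mulr0.
(* The new term of degree n meets the earlier ones in cross terms of frequency n - l > 0, which
   integrate to zero. The exponent is written as a successor to match [circle_integral_expi]. *)
have crossE t : normc (\sum_(l < n.+1) b l * expi t ^+ l) ^+ 2 =
    normc (\sum_(l < n) b l * expi t ^+ l) ^+ 2 + (normc (b n) ^+ 2 +
     \sum_(l < n) complex.Re (2 * b n * conjc (b l) * expi t ^+ (n - l.+1).+1)).
  have e1 : expi t * conjc (expi t) = 1 by rewrite -sqr_normcC normc_expi expr1n.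
  rewrite big_ord_recr /=; set S := \sum_(l < n) b l * expi t ^+ l.
  have -> : \sum_(l < n) complex.Re (2 * b n * conjc (b l) * expi t ^+ (n - l.+1).+1) =
      complex.Re (2 * (b n * expi t ^+ n) * conjc S).
    rewrite /S rmorph_sum mulr_sumr raddf_sum; apply: eq_bigr => l _.
    congr complex.Re; rewrite subnSK // rmorphM rmorphXn.
    have -> : expi t ^+ n = expi t ^+ (n - l) * expi t ^+ l.
      by rewrite -exprD subnK // ltnW.
    have : expi t ^+ l * conjc (expi t) ^+ l = 1 by rewrite -exprMn e1 expr1n.
    set X := expi t ^+ (n - l); set Y := expi t ^+ l; set Z := conjc (expi t) ^+ l => YZ.
    transitivity (2 * b n * conjc (b l) * X * (Y * Z)); first by rewrite YZ mulr1.
    by rewrite -!mulrA; ring.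
  have -> : normc (b n) ^+ 2 = normc (b n * expi t ^+ n) ^+ 2.
    by rewrite normcM normcX normc_expi expr1n mulr1.
  rewrite !sqr_normcE; move: (b n * _) S => [x y] [z w]; simpc => /=; ring.
under [X in circle_integral X _]eq_fun do rewrite crossE.
rewrite big_ord_recr mulrDr; apply: circle_integralD => //.
rewrite -[X in circle_integral _ X]addr0; apply: circle_integralD.
  exact: circle_integral_cst.
have := circle_integral_sum (index_enum _)
  (fun l : 'I_n => circle_integral_expi (2 * b n * conjc (b l)) (n - l.+1)).
by rewrite big1.
Qed.

Lemma circle_integral_ge f c m : circle_integral f c -> (forall t, m <= f t) ->
  2 * pi * m <= c.
Proof.
move=> [_ [F dF <-]] mf.
have pi0 : 0 < 2 * pi :> R by rewrite mulr_gt0 ?pi_gt0.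
have [|x _ ->] := @MVT R F f 0 (2 * pi) pi0 (fun x _ => dF x).
  apply: continuous_subspaceT => x; apply/differentiable_continuous.
  by apply/derivable1_diffP; have [] := dF x.
by rewrite subr0 mulrC ler_pM2r.
Qed.

Lemma circle_integral_le f c m : circle_integral f c -> (forall t, f t <= m) ->
  c <= 2 * pi * m.
Proof.
move=> [_ [F dF <-]] mf.
have pi0 : 0 < 2 * pi :> R by rewrite mulr_gt0 ?pi_gt0.
have [|x _ ->] := @MVT R F f 0 (2 * pi) pi0 (fun x _ => dF x).
  apply: continuous_subspaceT => x; apply/differentiable_continuous.
  by apply/derivable1_diffP; have [] := dF x.
by rewrite subr0 mulrC ler_pM2l.
Qed.

(* The integral of a nonnegative function is a supremum over simple functions
   below it, so G need not be measurable. *)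
Lemma circle_integral_le_integral f c (G : R -> \bar R) :
  circle_integral f c -> (forall t, (0 <= G t)%E) -> (forall t, ((f t)%:E <= G t)%E) ->
  (c%:E <= \int[lebesgue_measure]_(t in `[0%R, (2 * pi)%R]) G t)%E.
Proof.
move=> [cf [F dF <-]] G0 fG.
have pi0 : 0 < 2 * pi :> R by rewrite mulr_gt0 ?pi_gt0.
have cF x : F y @[y --> x] --> F x.
  apply/differentiable_continuous; apply/derivable1_diffP.
  by have [] := dF x.
have <- : (\int[lebesgue_measure]_(t in `[0%R, (2 * pi)%R]) (f t)%:E = (F (2 * pi) - F 0)%:E)%E.
  rewrite (@continuous_FTC2 R f F) ?EFinB //.
  - exact: continuous_subspaceT.
  - split; [|exact: cvg_at_right_filter|exact: cvg_at_left_filter].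
    by move=> x _; have [] := dF x.
  - by move=> x _; rewrite derive1E; apply: derive_val.
(* [f] may be negative, as it is for a square minus a small constant; its positive part is still
   below [G]. *)
pose g t := Num.max (f t) 0.
have cg : continuous g.
  by move=> t; apply: (@continuous_max _ _ f (fun=> 0)); [exact: cf|exact: cvg_cst].
apply: (@le_trans _ _ (\int[lebesgue_measure]_(t in `[0%R, (2 * pi)%R]) (g t)%:E)%E).
  apply: le_integral => //.
  - apply: continuous_compact_integrable; first exact: segment_compact.
    exact: continuous_subspaceT.
  - apply: continuous_compact_integrable; first exact: segment_compact.
    exact: continuous_subspaceT.
  by move=> t _; rewrite lee_fin le_max lexx.
rewrite !ge0_integralE //; last by move=> t _; rewrite lee_fin le_max lexx orbT.
apply: le_ereal_sup => _ [h hg <-]; exists h => // t.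
apply: le_trans (hg t) _; rewrite !patchE; case: ifP => // _.
by rewrite /g EFin_max ge_max fG G0.
Qed.

End CircleMeans.

(** * Parseval and Bessel estimates *)

Section Parseval.
Variable R : realType.
Local Notation C := R[i].
Implicit Types (b : ser C^o) (F : C -> C) (rho : R).

(** By Parseval, the mean of [|psum b n|^2] over the circle of radius [rho]. *)
Definition energy b n rho : R := \sum_(l < n) (normc (b l) * rho ^+ l) ^+ 2.

Lemma energy_le b m n rho : (m <= n)%N -> energy b m rho <= energy b n rho.
Proof.
move=> mn; rewrite /energy -(subnKC mn) big_split_ord /= lerDl.
by apply: sumr_ge0 => i _; exact: sqr_ge0.
Qed.

Lemma circle_integral_psum b n rho : 0 <= rho ->
  circle_integral (fun t => normc (psum b n ((rho%:C)%C * expi t)) ^+ 2)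
    (2 * pi * energy b n rho).
Proof.
move=> rho0; have := circle_integral_sq (fun l => b l * (rho%:C)%C ^+ l) n.
rewrite (_ : \sum_(l < n) _ = energy b n rho); last first.
  by apply: eq_bigr => l _; rewrite normcM normcX normc_real.
congr circle_integral; apply/funext => t; congr (normc _ ^+ 2).
by rewrite /psum; apply: eq_bigr => l _; rewrite exprMn mulrA.
Qed.

Lemma pser_bounded b F rho : pser b F -> 0 < rho < 1 ->
  exists2 B, 0 <= B & forall x, normc x <= rho -> normc (F x) <= B.
Proof.
move=> bF rho01; have [_ bU] := bF _ rho01; have [N HN] := bU 1 ltr01.
exists (1 + \sum_(l < N) normc (b l)).
  by rewrite addr_ge0 // sumr_ge0 // => i _; exact: normc_ge0.
move=> x xr; rewrite -(subrK (psum b N x) (F x)); apply: le_trans (ler_normcD _ _) _.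
apply: lerD; first exact: HN.
apply: le_trans (ler_normc_sum _ _) _; apply: ler_sum => l _.
rewrite normcM normcX ler_piMr ?normc_ge0 // exprn_ile1 ?normc_ge0 //.
by case/andP: rho01 => _ /ltW; exact: le_trans.
Qed.

Lemma pser_sq_approx b F rho eta : pser b F -> 0 < rho < 1 -> 0 < eta ->
  exists N, forall n, (N <= n)%N -> forall x, normc x <= rho ->
    `|normc (F x) ^+ 2 - normc (psum b n x) ^+ 2| <= eta.
Proof.
move=> bF rho01 eta0; have [B B0 FB] := pser_bounded bF rho01.
have [_ bU] := bF _ rho01.
(* |u^2 - v^2| = |u - v| (u + v), and u + v <= 2 B + 1 as soon as eps <= 1. *)
pose eps := Num.min 1 (eta / (2 * B + 1)).
have B1 : 0 < 2 * B + 1 by lra.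
have eps0 : 0 < eps by rewrite lt_min ltr01 divr_gt0.
have eps1 : eps <= 1 by rewrite ge_min lexx.
have eps2 : eps * (2 * B + 1) <= eta by rewrite -ler_pdivlMr // ge_min lexx orbT.
have [N HN] := bU _ eps0; exists N => n Nn x xr.
have d := HN n Nn x xr; have FBx := FB x xr.
have d1 := le_trans (ler_normcB _ _) d.
have d2 : normc (psum b n x) - normc (F x) <= eps.
  by apply: le_trans (ler_normcB _ _) _; rewrite normc_distC.
have := normc_ge0 (F x); have := normc_ge0 (psum b n x).
move: (normc _) (normc _) d1 d2 FBx => u v d1 d2 vB u0 v0.
have uv : `|u - v| <= eps by rewrite ler_norml; lra.
rewrite subr_sqr normrM; apply: le_trans eps2.
rewrite ler_pM //; first by rewrite distrC.
by rewrite ger0_norm; lra.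
Qed.

Section Family.
Variables (I : finType) (b : I -> ser C^o) (F : I -> C -> C).
Hypothesis bF : forall i, pser (b i) (F i).
Variable rho : R.
Hypothesis rho01 : 0 < rho < 1.

(** Finite families are treated jointly because the pointwise estimates used later hold for sums of
    squares: [phi] together with Szego kernels, or the coefficients of a slice. *)
Lemma family_sq_approx eta : 0 < eta ->
  exists N, forall n, (N <= n)%N -> forall x, normc x <= rho ->
    `|\sum_i normc (F i x) ^+ 2 - \sum_i normc (psum (b i) n x) ^+ 2| <= eta.
Proof.
move=> eta0; pose e := eta / #|I|.+1%:R.
have e0 : 0 < e by rewrite divr_gt0.
have [N HN] := choice (fun i => pser_sq_approx (bF i) rho01 e0).
exists (\max_i N i)%N => n Nn x xr; rewrite -sumrB.
apply: le_trans (ler_norm_sum _ _ _) _.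
apply: le_trans (_ : \sum_(i : I) e <= _).
  apply: ler_sum => i _; apply: HN => //; apply: leq_trans Nn.
  exact: leq_bigmax.
rewrite sumr_const -mulr_natr /e mulrAC ler_pdivrMr // ler_pM2l // ler_nat.
exact: leqnSn.
Qed.

Lemma circle_integral_family n :
  circle_integral (fun t => \sum_i normc (psum (b i) n ((rho%:C)%C * expi t)) ^+ 2)
    (2 * pi * \sum_i energy (b i) n rho).
Proof.
rewrite mulr_sumr; apply: circle_integral_sum => i; apply: circle_integral_psum.
by apply: ltW; case/andP: rho01.
Qed.

Lemma normc_circle t : normc ((rho%:C)%C * expi t) = rho.
Proof.
by rewrite normcM normc_expi mulr1 normc_real // ltW; case/andP: rho01.
Qed.

Lemma parseval_ge m : (forall x, normc x = rho -> m <= \sum_i normc (F i x) ^+ 2) ->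
  forall eta, 0 < eta -> exists N, forall n, (N <= n)%N ->
    m - eta <= \sum_i energy (b i) n rho.
Proof.
move=> mF eta eta0; have [N HN] := family_sq_approx eta0; exists N => n Nn.
have pi0 : 0 < 2 * pi :> R by rewrite mulr_gt0 ?pi_gt0.
rewrite -(ler_pM2l pi0); apply: circle_integral_ge (circle_integral_family n) _ => t.
have := HN n Nn ((rho%:C)%C * expi t); rewrite normc_circle lexx => /(_ isT).
rewrite ler_norml => /andP[_]; have := mF ((rho%:C)%C * expi t) (normc_circle t).
lra.
Qed.

Lemma parseval_le m : (forall x, normc x = rho -> \sum_i normc (F i x) ^+ 2 <= m) ->
  forall n, \sum_i energy (b i) n rho <= m.
Proof.
move=> mF n; apply/ler_addgt0Pr => eta eta0.
have [N HN] := family_sq_approx eta0.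
have pi0 : 0 < 2 * pi :> R by rewrite mulr_gt0 ?pi_gt0.
apply: le_trans (_ : \sum_i energy (b i) (maxn n N) rho <= _).
  by apply: ler_sum => i _; apply: energy_le; exact: leq_maxl.
rewrite -(ler_pM2l pi0); apply: circle_integral_le (circle_integral_family _) _ => t.
have := HN _ (leq_maxr n N) ((rho%:C)%C * expi t); rewrite normc_circle lexx => /(_ isT).
rewrite ler_norml => /andP[+ _]; have := mF ((rho%:C)%C * expi t) (normc_circle t).
lra.
Qed.

(** [G] is an arbitrary majorant so that it can be the inner integral of [H2_integral], taken as a
    function of the outer angle. *)
Lemma bessel_integral (G : R -> \bar R) :
  (forall t, ((\sum_i normc (F i ((rho%:C)%C * expi t)) ^+ 2)%:E <= G t)%E) ->
  forall n, ((2 * pi * \sum_i energy (b i) n rho)%:E <=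
    \int[lebesgue_measure]_(t in `[0%R, (2 * pi)%R]) G t)%E.
Proof.
move=> FG n.
have G0 t : (0 <= G t)%E.
  apply: le_trans (FG t); rewrite lee_fin; apply: sumr_ge0 => i _; exact: sqr_ge0.
have pi0 : 0 < 2 * pi :> R by rewrite mulr_gt0 ?pi_gt0.
apply/lee_addgt0Pr => e e0; rewrite -leeBlDr // -EFinB.
pose eta := e / (2 * pi).
have eta0 : 0 < eta by rewrite divr_gt0.
have [N HN] := family_sq_approx eta0.
have ci := circle_integralD (circle_integral_family (maxn n N)) (circle_integral_cst (- eta)).
apply: le_trans (circle_integral_le_integral ci G0 _).
  have -> : 2 * pi * - eta = - e by rewrite mulrN /eta mulrC divfK ?gt_eqF.
  rewrite lee_fin lerD2r ler_pM2l //; apply: ler_sum => i _; apply: energy_le; exact: leq_maxl.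
move=> t; apply: le_trans (FG t); rewrite lee_fin.
have := HN _ (leq_maxr n N) ((rho%:C)%C * expi t); rewrite normc_circle lexx => /(_ isT).
rewrite ler_norml => /andP[+ _]; lra.
Qed.

End Family.

Lemma slice_series (P q : {poly {poly C}}) x : eval2 P x 0 != 0 ->
  exists a : ser C^o, slice P x *: a = ser_of_poly (slice q x).
Proof.
move=> P0; apply: (@ser_divisible _ C^o) => v; exists (((slice P x)`_0)^-1 * v).
by rewrite -horner_coef0 horner_slice [_ *: _]mulrA divff // mul1r.
Qed.

(** Bessel is applied twice: in z for fixed x, which bounds the inner integral below by the energy
    of [alpha x], and then in x to the family of coefficient functions of the slices. *)
Lemma double_bessel (P q : {poly {poly C}}) (B : ser (ser C^o)) (f : C -> C -> C) rho :
  (forall x z, normc x < 1 -> normc z < 1 -> eval2 P x z != 0) ->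
  P *: B = ser2_of_poly q -> 0 < rho < 1 ->
  (forall x z, normc x = rho -> normc z = rho ->
    normc (eval2 q x z / eval2 P x z) <= normc (f x z)) ->
  forall L K, ((\sum_(l < L) \sum_(k < K) (normc (B l k) * rho ^+ k * rho ^+ l) ^+ 2)%:E
    <= H2_integral f rho)%E.
Proof.
move=> Pnz PB rho01 qf L K.
have /andP[rho0 rho1] := rho01.
have pi0 : 0 < 2 * pi :> R by rewrite mulr_gt0 ?pi_gt0.
have /choice[alpha alphaP] : forall x, exists a : ser C^o, normc x < 1 ->
    slice P x *: a = ser_of_poly (slice q x).
  move=> x; have [x1|x1] := boolP (normc x < 1); last by exists 0.
  have [|a aP] := @slice_series P q x; last by exists a.
  by apply: Pnz => //; rewrite normc0.
have Bpser := double_pser (P := P) (q := q) (B := B) (alpha := alpha).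
have {}Bpser l : pser (B l) (fun x => alpha x l).
  apply: Bpser => // x x1; rewrite -coef_slice -horner_coef0 horner_slice.
  by apply: Pnz => //; rewrite normc0.
have apser x : normc x < 1 -> pser (alpha x) (fun z => eval2 q x z / eval2 P x z).
  move=> x1; have := pser_of_poly (slice q x).
  rewrite -alphaP // => /(pser_div (D := slice P x)) H.
  apply: eq_pser (H _) => [z z1|z z1]; rewrite !horner_slice //.
  exact: Pnz.
rewrite /H2_integral.
pose inner t1 := (\int[lebesgue_measure]_(t2 in `[0%R, (2 * pi)%R])
   ((complex.Re (`| f ((rho%:C)%C * expi t1) ((rho%:C)%C * expi t2) | ^+ 2))%R)%:E)%E.
have innerP t1 : ((2 * pi * energy (alpha ((rho%:C)%C * expi t1)) L rho)%:E <= inner t1)%E.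
  have nx : normc ((rho%:C)%C * expi t1) < 1 by rewrite normc_circle.
  have := @bessel_integral 'I_1 _ _ (fun=> apser _ nx) _ rho01 (fun t2 =>
   ((complex.Re (`| f ((rho%:C)%C * expi t1) ((rho%:C)%C * expi t2) | ^+ 2))%R)%:E)%E.
  move=> /(_ _ L); rewrite big_ord1; apply => t2.
  rewrite big_ord1 Re_sqr_normr lee_fin lerXn2r ?nnegrE ?normc_ge0 //.
  by apply: qf; rewrite normc_circle.
(* These weights make the sum of squares of the family equal to the lower bound [innerP] of the
   inner integral. *)
pose a l : C := ((Num.sqrt (2 * pi) * rho ^+ l)%:C)%C.
have na l : normc (a l) = Num.sqrt (2 * pi) * rho ^+ l.
  by rewrite normc_real // mulr_ge0 ?sqrtr_ge0 ?exprn_ge0 // ltW.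
have sq : Num.sqrt (2 * pi) ^+ 2 = 2 * pi :> R by rewrite sqr_sqrtr // ltW.
have := @bessel_integral 'I_L _ _ (fun l => pser_scaleC (a l) (Bpser l)) _ rho01 inner.
move=> /(_ _ K); set J := (X in (_ <= X)%E) => HJ.
have {}HJ : ((2 * pi * (2 * pi * \sum_(l < L) \sum_(k < K)
    (normc (B l k) * rho ^+ k * rho ^+ l) ^+ 2))%:E <= J)%E.
  apply: le_trans (HJ _).
    rewrite lee_fin ler_pM2l // mulr_sumr; apply: ler_sum => l _.
    rewrite /energy mulr_sumr; apply: ler_sum => k _.
    rewrite serZ_recl coefC eqxx big1 ?addr0; last by move=> i _; rewrite coefC scale0r.
    rewrite [_ *: _]/(_ * _) normcM na -[X in X * _ <= _]sq -!exprMn.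
    by rewrite le_eqVlt; apply/orP; left; apply/eqP; congr (_ ^+ 2); ring.
  move=> t1; apply: le_trans (innerP t1); rewrite lee_fin /energy mulr_sumr.
  apply: ler_sum => l _; rewrite normcM na -[X in _ <= X * _]sq -exprMn.
  by rewrite le_eqVlt; apply/orP; left; apply/eqP; congr (_ ^+ 2); ring.
rewrite -[X in (_ * X)%E]/J.
have p4 : 0 < 4 * pi ^+ 2 :> R by rewrite mulr_gt0 ?exprn_gt0 ?pi_gt0.
rewrite -lee_pdivrMl ?invr_gt0 // invrK -EFinM.
by apply: le_trans HJ; rewrite lee_fin le_eqVlt; apply/orP; left; apply/eqP; ring.
Qed.

End Parseval.

(** Finite coefficient sums are polynomials in the radius, so a bound valid for all radii below 1
    holds at 1 by continuity. *)
Lemma horner_le_at1 (R : realType) (p : {poly R}) (M : R) :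
  (forall r, 0 < r < 1 -> p.[r] <= M) -> p.[1] <= M.
Proof.
move=> pM; rewrite leNgt; apply/negP => Mp.
have := @continuous_horner R p 1; move=> /cvgr_dist_lt/(_ (p.[1] - M)).
rewrite subr_gt0 => /(_ Mp)/nbhs_ballP[e /= e0 He].
pose d := Num.min (e / 2) (1 / 2).
have d0 : 0 < d by rewrite lt_min !divr_gt0.
have d1 : d <= 1 / 2 by rewrite ge_min lexx orbT.
have de : d <= e / 2 by rewrite ge_min lexx.
have := He (1 - d); rewrite /ball /= opprB addrC subrK ger0_norm ?ltW // => /(_ _) H.
have /H : d < e by lra.
rewrite ltr_norml => /andP[_]; have := pM (1 - d); lra.
Qed.

(** * Blaschke factors and Szego kernels *)

Section Blaschke.
Variable R : realType.
Local Notation C := R[i].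
Implicit Types (gam z : C) (g : seq C).

Lemma one_sub_prod_le g (t : C -> R) : {in g, forall gam, 0 <= t gam <= 1} ->
  0 <= \prod_(gam <- g) t gam <= 1 /\
  1 - \prod_(gam <- g) t gam <= \sum_(gam <- g) (1 - t gam).
Proof.
elim: g => [_|gam g IHg t01]; first by rewrite !big_nil; lra.
have [|/andP[p0 p1] IH] := IHg.
  by move=> x xg; apply: t01; rewrite inE xg orbT.
rewrite !big_cons; have /andP[t0 t1] := t01 gam (mem_head _ _); nra.
Qed.

(** The second-order companion of the previous bound: 1 minus the product differs from the sum s of
    the defects by at most s^2. On |z| = rho the defects are of order 1 - rho^2, so the error
    disappears after division by 1 - rho^2. *)
Lemma one_sub_prod_ge g (t : C -> R) : {in g, forall gam, 0 <= t gam <= 1} ->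
  \prod_(gam <- g) t gam <=
    1 - \sum_(gam <- g) (1 - t gam) + (\sum_(gam <- g) (1 - t gam)) ^+ 2.
Proof.
elim: g => [_|gam g IHg t01]; first by rewrite !big_nil; lra.
have t01' : {in g, forall gam, 0 <= t gam <= 1}.
  by move=> x xg; apply: t01; rewrite inE xg orbT.
have [/andP[p0 p1] H] := one_sub_prod_le t01'.
have IH := IHg t01'.
rewrite !big_cons; have /andP[t0 t1] := t01 gam (mem_head _ _); nra.
Qed.

(* The squared modulus of the Blaschke factor with zero at the conjugate of gam. *)
Definition blaschke_sq gam z : R := (normc (z - conjc gam) / normc (1 - gam * z)) ^+ 2.

Lemma blaschke_denom gam z : normc gam <= 1 -> normc z < 1 -> 1 - gam * z != 0.
Proof.
move=> g1 z1; rewrite -normc_gt0; apply: lt_le_trans (ler_normcB _ _).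
rewrite normc1 normcM; have := normc_ge0 gam; have := normc_ge0 z; nra.
Qed.

(** The Szego kernel of the disc at the point [conjc gam], normalized in H^2; it degenerates to zero
    when [gam] has modulus one. *)
Definition szego gam z : C := ((Num.sqrt (1 - normc gam ^+ 2))%:C)%C / (1 - gam * z).

Definition szego_ser gam : ser C^o :=
  fun l => ((Num.sqrt (1 - normc gam ^+ 2))%:C)%C * gam ^+ l.

(** Comes from |1 - gam z|^2 - |z - conj gam|^2 = (1 - |z|^2)(1 - |gam|^2). It turns the defect of a
    Blaschke factor into a square, to which Parseval applies. *)
Lemma blaschke_sqE gam z : normc gam <= 1 -> normc z < 1 ->
  1 - blaschke_sq gam z = (1 - normc z ^+ 2) * normc (szego gam z) ^+ 2.
Proof.
move=> g1 z1; have D0 := blaschke_denom g1 z1.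
have g2 : 0 <= 1 - normc gam ^+ 2.
  by rewrite subr_ge0 exprn_ile1 ?normc_ge0.
have nD : normc (1 - gam * z) ^+ 2 != 0 by rewrite expf_eq0 /= normc_eq0.
rewrite /blaschke_sq /szego normcM normcV normc_real ?sqrtr_ge0 // !exprMn !exprVn.
have key : (1 - normc z ^+ 2) * (1 - normc gam ^+ 2) =
    normc (1 - gam * z) ^+ 2 - normc (z - conjc gam) ^+ 2.
  rewrite !sqr_normcE {D0 nD g1 g2 z1}.
  by case: gam z => a b [c d]; simpc => /=; ring.
by rewrite sqr_sqrtr // mulrA key mulrBl divff.
Qed.

Lemma blaschke_sq01 gam z : normc gam <= 1 -> normc z < 1 -> 0 <= blaschke_sq gam z <= 1.
Proof.
move=> g1 z1; rewrite sqr_ge0 /= -subr_ge0 blaschke_sqE // mulr_ge0 ?sqr_ge0 //.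
by rewrite subr_ge0 exprn_ile1 ?normc_ge0 // ltW.
Qed.

Lemma szego_pser gam : normc gam <= 1 -> pser (szego_ser gam) (szego gam).
Proof.
move=> g1; set s : C := ((Num.sqrt (1 - normc gam ^+ 2))%:C)%C.
have E : (1 - gam *: 'X) *: szego_ser gam = ser_of_poly s%:P.
  apply/funext => l.
  rewrite scalerBl scale1r -mul_polyC mulrC -scalerA.
  rewrite [LHS](_ : _ = szego_ser gam l - ('X *: (gam%:P *: szego_ser gam)) l) //.
  rewrite serX_E /ser_of_poly coefC; case: l => [|l]; first by rewrite subr0 /szego_ser expr0 mulr1.
  rewrite serZ_recl coefC eqxx big1 ?addr0 => [|i _]; last by rewrite coefC scale0r.
  by rewrite /szego_ser [_ *: _]mulrCA -exprS subrr.
have := pser_of_poly s%:P; rewrite -E => /(pser_div (D := 1 - gam *: 'X)) H.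
have hE z : (1 - gam *: 'X).[z] = 1 - gam * z by rewrite !hornerE.
apply: eq_pser (H _) => [z z1|z z1]; rewrite hE ?hornerC //.
exact: blaschke_denom.
Qed.

Lemma szego_energyE gam rho n : 0 < rho < 1 -> normc gam <= 1 ->
  energy (szego_ser gam) n rho =
  (1 - normc gam ^+ 2) * \sum_(l < n) ((normc gam * rho) ^+ 2) ^+ l.
Proof.
move=> rho01 g1; have g2 : 0 <= 1 - normc gam ^+ 2.
  by rewrite subr_ge0 exprn_ile1 ?normc_ge0.
rewrite mulr_sumr /energy; apply: eq_bigr => l _.
rewrite normcM normcX normc_real ?sqrtr_ge0 //.
rewrite -[X in _ = X * _](sqr_sqrtr g2) -exprM mulnC exprM -exprMn.
by rewrite [(normc gam * rho) ^+ l]exprMn mulrA.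
Qed.

Lemma geometric_sum (y : R) n : (1 - y) * (\sum_(l < n) y ^+ l) = 1 - y ^+ n.
Proof. by rewrite -opprB mulNr -subrX1 opprB. Qed.

(** The factor 1 - |gam|^2 cancels the geometric sum inside the disc and vanishes on the circle.
    Summed over [gam], the bound counts the zeros in the open disc. *)
Lemma szego_energy_le gam rho n : 0 < rho < 1 -> normc gam <= 1 ->
  energy (szego_ser gam) n rho <= ((normc gam < 1)%R : bool)%:R.
Proof.
move=> rho01 g1; rewrite szego_energyE //; have /andP[rho0 rho1] := rho01.
have g0 := normc_ge0 gam.
case: ltP => [glt|gge]; last first.
  have -> : normc gam = 1 by apply/eqP; rewrite eq_le g1 gge.
  by rewrite expr1n subrr mul0r.
set y := (normc gam * rho) ^+ 2.
have y0 : 0 <= y by exact: sqr_ge0.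
have yg : y <= normc gam ^+ 2.
  have r0 := ltW rho0; have r1 := ltW rho1.
  by apply: lerXn2r; rewrite ?nnegrE ?mulr_ge0 // ler_piMr.
have S0 : 0 <= \sum_(l < n) y ^+ l by apply: sumr_ge0 => i _; exact: exprn_ge0.
apply: le_trans (_ : (1 - y) * \sum_(l < n) y ^+ l <= _).
  by rewrite ler_wpM2r // lerB.
by rewrite geometric_sum lerBlDr lerDl exprn_ge0.
Qed.

Lemma szego_energy_ge gam rho n : 0 < rho < 1 -> normc gam < 1 ->
  1 - (normc gam ^+ 2) ^+ n - (1 - rho ^+ 2) / (1 - normc gam ^+ 2)
   <= energy (szego_ser gam) n rho.
Proof.
move=> rho01 glt; rewrite szego_energyE // ?(ltW glt) //; have /andP[rho0 rho1] := rho01.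
have g0 := normc_ge0 gam.
have gg : normc gam ^+ 2 < 1 by rewrite expr_lt1.
have rr : rho ^+ 2 < 1 by rewrite expr_lt1 // ltW.
rewrite [(normc gam * rho) ^+ 2]exprMn; move: (normc gam ^+ 2) (rho ^+ 2) (sqr_ge0 (normc gam)) (sqr_ge0 rho) gg rr.
move=> G r G0 r0 G1 r1.
have y1 : G * r <= G by rewrite ler_piMr // ltW.
have y0 : 0 <= G * r by exact: mulr_ge0.
have yn : (G * r) ^+ n <= G ^+ n by rewrite lerXn2r.
have GS := geometric_sum (G * r) n.
have S0 : 0 <= \sum_(l < n) (G * r) ^+ l by apply: sumr_ge0 => i _; exact: exprn_ge0.
move: (\sum_(l < n) _) S0 GS => S S0 GS.
have S1 : S <= 1 / (1 - G).
  by rewrite ler_pdivlMr ?subr_gt0 // mulrC; have := exprn_ge0 n y0; nra.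
have -> : (1 - G) * S = (1 - G * r) * S - G * (1 - r) * S by ring.
rewrite GS; have : G * (1 - r) * S <= (1 - r) / (1 - G).
  have -> : G * (1 - r) * S = (1 - r) * (G * S) by ring.
  rewrite ler_pM2l ?subr_gt0 // -[leRHS]mul1r; apply: le_trans (_ : 1 * S <= _); last by rewrite mul1r mul1r -div1r.
  by rewrite ler_wpM2r // ltW.
lra.
Qed.

Lemma szego_bound gam z : normc gam < 1 -> normc z < 1 ->
  normc (szego gam z) ^+ 2 <= (1 - normc gam)^-1 ^+ 2.
Proof.
move=> g1 z1; have := normc_ge0 gam; have := normc_ge0 z => z0 g0.
rewrite lerXn2r ?nnegrE ?normc_ge0 ?invr_ge0 ?subr_ge0 ?(ltW g1) //.
rewrite /szego normcM normcV normc_real ?sqrtr_ge0 //.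
have s1 : Num.sqrt (1 - normc gam ^+ 2) <= 1.
  by rewrite -[leRHS]sqrtr1 ler_wsqrtr // gerBl sqr_ge0.
have d1 : 1 - normc gam <= normc (1 - gam * z).
  by apply: le_trans (ler_normcB _ _); rewrite normc1 normcM lerB // ler_piMr // ltW.
have d0 : 0 < 1 - normc gam by rewrite subr_gt0.
rewrite -[leRHS]mul1r ler_pM ?sqrtr_ge0 ?invr_ge0 ?normc_ge0 //.
by rewrite lef_pV2 // posrE // (lt_le_trans d0).
Qed.

End Blaschke.

(** * The Dirichlet integral as a count of zeros *)

Section BlaschkeDirichlet.
Variable R : realType.
Local Notation C := R[i].

Definition dirichlet (a : ser C^o) L : R := \sum_(l < L) normc (a l) ^+ 2 *+ l.

Variables (alpha : ser C^o) (phi : C -> C) (g : seq C).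
Hypothesis phi_ser : pser alpha phi.
Hypothesis g1 : {in g, forall gam, normc gam <= 1}.
(** The origin is excluded since the reflection formula divides by z; circles of positive radius
    avoid it. *)
Hypothesis phiE : forall z, 0 < normc z < 1 ->
  normc (phi z) ^+ 2 = \prod_(gam <- g) blaschke_sq gam z.

(** Member 0 is [phi]; the others are Szego kernels scaled so that on |z| = rho their squares are
    the defects 1 - |b|^2. The total is the product plus the sum of the defects, which the two
    product inequalities place between 1 and 1 + s^2. *)
Let fam_ser (rho : R) (i : 'I_(size g).+1) : ser C^o :=
  if nat_of_ord i is j.+1 then (((Num.sqrt (1 - rho ^+ 2))%:C)%C)%:P *: szego_ser g`_j
  else alpha.

Let fam_fun (rho : R) (i : 'I_(size g).+1) (z : C) : C :=
  if nat_of_ord i is j.+1 then ((Num.sqrt (1 - rho ^+ 2))%:C)%C * szego g`_j z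
  else phi z.

Let fam_pser rho i : pser (fam_ser rho i) (fam_fun rho i).
Proof.
case: i => -[|j] //= lij; rewrite /fam_ser /fam_fun /=.
by apply: pser_scaleC; apply: szego_pser; apply: g1; exact: mem_nth.
Qed.

Let fam_energy rho n : 0 < rho < 1 ->
  \sum_i energy (fam_ser rho i) n rho =
  energy alpha n rho + (1 - rho ^+ 2) * \sum_(gam <- g) energy (szego_ser gam) n rho.
Proof.
move=> /andP[rho0 rho1]; rewrite big_ord_recl /fam_ser /=; congr (_ + _).
have r2 : 0 <= 1 - rho ^+ 2 by rewrite subr_ge0 exprn_ile1 // ltW.
rewrite mulr_sumr (big_nth 0) big_mkord; apply: eq_bigr => i _.
rewrite /energy mulr_sumr; apply: eq_bigr => l _ /=.
rewrite serZ_recl coefC eqxx big1 ?addr0 => [|j _]; last by rewrite coefC scale0r.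
rewrite [_ *: _]/(_ * _) normcM normc_real ?sqrtr_ge0 // -mulrA exprMn sqr_sqrtr //.
Qed.

Let fam_sq rho z : 0 < rho < 1 -> normc z = rho ->
  \sum_i normc (fam_fun rho i z) ^+ 2 =
  \prod_(gam <- g) blaschke_sq gam z + \sum_(gam <- g) (1 - blaschke_sq gam z).
Proof.
move=> /andP[rho0 rho1] zr; rewrite big_ord_recl /fam_fun /= phiE ?zr ?rho0 //.
have r2 : 0 <= 1 - rho ^+ 2 by rewrite subr_ge0 exprn_ile1 // ltW.
congr (_ + _); rewrite [RHS]big_seq (eq_bigr (fun gam =>
  (1 - rho ^+ 2) * normc (szego gam z) ^+ 2)) => [|gam gamg]; last first.
  by rewrite blaschke_sqE ?zr // g1.
rewrite -big_seq (big_nth 0) big_mkord; apply: eq_bigr => i _ /=.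
by rewrite normcM normc_real ?sqrtr_ge0 // exprMn sqr_sqrtr.
Qed.

Let bl01 z : normc z < 1 -> {in g, forall gam, 0 <= blaschke_sq gam z <= 1}.
Proof. by move=> z1 gam gamg; rewrite blaschke_sq01 // g1. Qed.

Let ncount : R := (count (fun gam => (normc gam < 1)%R) g)%:R.

Let szego_sum_le rho n : 0 < rho < 1 ->
  \sum_(gam <- g) energy (szego_ser gam) n rho <= ncount.
Proof.
move=> rho01; rewrite /ncount -sum1_count natr_sum [leRHS]big_mkcond /=.
rewrite big_seq [leRHS]big_seq; apply: ler_sum => gam gamg.
by apply: le_trans (szego_energy_le n rho01 (g1 gamg)) _; case: ifP.
Qed.

Let energy_ge rho eta : 0 < rho < 1 -> 0 < eta -> exists N, forall n, (N <= n)%N ->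
  1 - eta <= energy alpha n rho + (1 - rho ^+ 2) * ncount.
Proof.
move=> rho01 eta0; have /andP[rho0 rho1] := rho01.
have r2 : 0 <= 1 - rho ^+ 2 by rewrite subr_ge0 exprn_ile1 // ltW.
have [z zr|N HN] := parseval_ge (fam_pser rho) rho01 (m := 1) _ eta0.
  have z1 : normc z < 1 by rewrite zr.
  by rewrite fam_sq // -lerBlDl; have [] := one_sub_prod_le (bl01 z1).
exists N => n /HN; rewrite fam_energy // => /le_trans; apply.
by rewrite lerD2l ler_wpM2l // szego_sum_le.
Qed.

Lemma blaschke_energy_le1 n : energy alpha n 1 <= 1.
Proof.
have le1 rho : 0 < rho < 1 -> energy alpha n rho <= 1.
  move=> rho01; have := @parseval_le _ 'I_1 _ _ (fun=> phi_ser) _ rho01 1.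
  move=> /(_ _ n); rewrite big_ord1; apply => z zr; rewrite big_ord1 phiE ?zr //.
  have z1 : normc z < 1 by rewrite zr; case/andP: rho01.
  by have [/andP[]] := one_sub_prod_le (bl01 z1).
pose p : {poly R} := \sum_(l < n) (normc (alpha l) ^+ 2) *: 'X^(l * 2).
have pE rho : p.[rho] = energy alpha n rho.
  rewrite horner_sum; apply: eq_bigr => l _.
  by rewrite hornerZ hornerXn exprMn exprM.
by rewrite -pE; apply: horner_le_at1 => r /le1; rewrite pE.
Qed.

Let energy_sub rho n : 0 < rho < 1 ->
  energy alpha n 1 - energy alpha n rho =
  \sum_(l < n) normc (alpha l) ^+ 2 * (1 - (rho ^+ 2) ^+ l).
Proof.
move=> rho01; rewrite /energy -sumrB; apply: eq_bigr => l _.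
by rewrite expr1n mulr1 exprMn mulrBr mulr1 exprAC.
Qed.

(** 1 - y^l is 1 - y times a sum of l powers lying between y^l and 1. With y = rho^2 this compares
    the loss of energy between radii 1 and rho with the Dirichlet sum. *)
Let expr_sub_bounds (y : R) l : 0 <= y <= 1 ->
  (1 - y) * (l%:R * y ^+ l) <= 1 - y ^+ l <= (1 - y) * l%:R.
Proof.
move=> /andP[y0 y1]; elim: l => [|l /andP[IH1 IH2]].
  by rewrite expr0 mul0r mulr0 subrr lexx.
have yl0 : 0 <= y ^+ l by exact: exprn_ge0.
have yl1 : y ^+ l <= 1 by exact: exprn_ile1.
have l0 : 0 <= l%:R :> R by [].
rewrite exprS -natr1; move: (y ^+ l) (l%:R : R) IH1 IH2 yl0 yl1 l0 => Y K IH1 IH2 Y0 Y1 K0.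
have yY : y * (1 - Y) <= 1 - Y by rewrite ler_piMl // subr_ge0.
have A : y * ((1 - y) * (K * Y)) <= y * (1 - Y) by rewrite ler_wpM2l.
have B : (1 - y) * (y * Y) <= 1 - y.
  by rewrite ler_piMr ?subr_ge0 // mulr_ile1.
by apply/andP; split; lra.
Qed.

(** The energy is at most 1 at radius 1 and, up to any eta, at least 1 - (1 - rho^2) [ncount] at
    radius rho. Dividing the difference by 1 - rho^2 bounds a Dirichlet sum with weights rho^(2l),
    and then rho tends to 1. *)
Lemma blaschke_dirichlet_le L : dirichlet alpha L <= ncount.
Proof.
pose p : {poly R} := \sum_(l < L) (normc (alpha l) ^+ 2 * l%:R) *: 'X^(l * 2).
have pE rho : p.[rho] = \sum_(l < L) normc (alpha l) ^+ 2 * (l%:R * (rho ^+ 2) ^+ l).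
  rewrite horner_sum; apply: eq_bigr => l _.
  by rewrite hornerZ hornerXn mulrA -exprM mulnC.
have -> : dirichlet alpha L = p.[1].
  by rewrite pE; apply: eq_bigr => l _; rewrite !expr1n mulr1 mulr_natr.
apply: horner_le_at1 => rho rho01; have /andP[rho0 rho1] := rho01.
have r2 : 0 < 1 - rho ^+ 2 by rewrite subr_gt0 expr_lt1 // ltW.
have r201 : 0 <= rho ^+ 2 <= 1 by rewrite sqr_ge0 /= -subr_ge0 ltW.
rewrite pE -(ler_pM2l r2); apply/ler_addgt0Pr => eta eta0.
have [N HN] := energy_ge rho01 eta0.
pose n := maxn N L.
apply: le_trans (_ : energy alpha n 1 - energy alpha n rho <= _); last first.
  by have := blaschke_energy_le1 n; have := HN n (leq_maxl _ _); lra.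
rewrite energy_sub // mulr_sumr.
apply: le_trans (_ : \sum_(l < L) normc (alpha l) ^+ 2 * (1 - (rho ^+ 2) ^+ l) <= _).
  apply: ler_sum => l _; rewrite mulrCA ler_wpM2l ?sqr_ge0 //.
  by have /andP[] := expr_sub_bounds l r201.
rewrite -(subnKC (leq_maxr N L : (L <= n)%N)) big_split_ord /= lerDl.
apply: sumr_ge0 => l _; rewrite mulr_ge0 ?sqr_ge0 // subr_ge0 exprn_ile1 ?sqr_ge0 //.
by case/andP: r201.
Qed.

(** The converse estimate at one fixed radius, with explicit errors. Any margin below 1 separates
    the counts n and n - 1; the margin 1/2 leaves room for the approximations made in the main
    proof. *)
Lemma blaschke_dirichlet_ge : {in g, forall gam, normc gam < 1} ->
  exists L, (size g)%:R - 1 / 2 < dirichlet alpha L.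
Proof.
move=> glt.
pose c1 := \sum_(gam <- g) (1 - normc gam)^-1 ^+ 2.
pose c2 := \sum_(gam <- g) (1 - normc gam ^+ 2)^-1.
have c10 : 0 <= c1 by apply: sumr_ge0 => gam _; exact: sqr_ge0.
have c20 : 0 <= c2.
  rewrite /c2 big_seq; apply: sumr_ge0 => gam gamg; rewrite invr_ge0 subr_ge0.
  by rewrite exprn_ile1 ?normc_ge0 // ltW // glt.
set S : R := (size g)%:R; have S0 : 0 <= S by [].
have radius (h : R) : 0 < h -> exists2 rho, 0 < rho < 1 & 0 < 1 - rho ^+ 2 <= h.
  move=> h0; pose k := Num.min (1 / 2) h.
  have k0 : 0 < k by rewrite lt_min h0 divr_gt0.
  have k12 : k <= 1 / 2 by rewrite ge_min lexx.
  have kh : k <= h by rewrite ge_min lexx orbT.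
  have k1 : 0 < 1 - k by lra.
  exists (Num.sqrt (1 - k)).
    by rewrite sqrtr_gt0 k1 -[ltRHS]sqrtr1 ltr_sqrt //; lra.
  by rewrite sqr_sqrtr; lra.
(* Two errors are proportional to h = 1 - rho^2: [h * c1 ^+ 2] from the product inequality and
   [h * c2] from the energies of the kernels. This bound on h keeps their sum below 1/8. *)
have c0 : 0 < (8 * (c1 ^+ 2 + c2 + 1))^-1.
  by rewrite invr_gt0; have := sqr_ge0 c1; lra.
have [rho rho01 /andP[]] := radius _ c0.
set h := 1 - rho ^+ 2 => h0 hle.
have hc : h * (c1 ^+ 2 + c2) <= 1 / 8.
  have d0 : 0 < 8 * (c1 ^+ 2 + c2 + 1) by rewrite -invr_gt0.
  have := hle; rewrite -[_^-1]mul1r ler_pdivlMr //; lra.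
have /andP[rho0 rho1] := rho01.
have up k : energy alpha k rho + h * \sum_(gam <- g) energy (szego_ser gam) k rho
    <= 1 + (h * c1) ^+ 2.
  rewrite -fam_energy //; apply: (parseval_le (fam_pser rho) rho01) => z zr.
  have z1 : normc z < 1 by rewrite zr.
  rewrite fam_sq //; have := one_sub_prod_ge (bl01 z1).
  set s := \sum_(gam <- g) _; set p := \prod_(gam <- g) _ => ps.
  apply: le_trans (_ : 1 + s ^+ 2 <= _); first by lra.
  have s0 : 0 <= s.
    rewrite /s big_seq; apply: sumr_ge0 => gam gamg; rewrite subr_ge0.
    by have /andP[] := bl01 z1 gamg.
  rewrite lerD2l lerXn2r ?nnegrE // ?mulr_ge0 // ?(ltW h0) //.
  rewrite /s /c1 mulr_sumr big_seq [leRHS]big_seq; apply: ler_sum => gam gamg.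
  rewrite blaschke_sqE ?zr ?g1 // ler_pM2l //.
  by apply: szego_bound => //; exact: glt.
have [K HK] : exists K, forall k, (K <= k)%N -> \sum_(gam <- g) (normc gam ^+ 2) ^+ k <= 1 / 16.
  have /choice[N HN] : forall gam : C, exists N, normc gam < 1 -> forall k, (N <= k)%N ->
      (S + 1) * (normc gam ^+ 2) ^+ k <= 1 / 16.
    move=> gam; have [gl|gl] := boolP (normc gam < 1)%R; last by exists 0%N.
    have q01 : 0 <= normc gam ^+ 2 < 1 by rewrite sqr_ge0 /= expr_lt1 // normc_ge0.
    have e16 : 0 < 1 / 16 :> R by lra.
    by have [N HN] := geometric_small (S + 1) q01 e16; exists N => _; exact: HN.
  exists (\max_(gam <- g) N gam)%N => k Kk.
  apply: le_trans (_ : \sum_(gam <- g) (1 / 16) / (S + 1) <= _).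
    rewrite big_seq [leRHS]big_seq; apply: ler_sum => gam gamg.
    rewrite ler_pdivlMr; last by lra.
    rewrite mulrC; apply: HN; first exact: glt.
    by apply: leq_trans Kk; apply: leq_bigmax_seq.
  rewrite big_const_seq count_predT iter_addr_0 -(mulr_natr _ (size g)) -/S.
  by rewrite mulrAC ler_pdivrMr; lra.
have low k : (K <= k)%N ->
    S - 1 / 16 - h * c2 <= \sum_(gam <- g) energy (szego_ser gam) k rho.
  move=> /HK Hk; apply: le_trans (_ : \sum_(gam <- g)
     (1 - (normc gam ^+ 2) ^+ k - h / (1 - normc gam ^+ 2)) <= _).
    rewrite !sumrB -mulr_sumr big_const_seq count_predT iter_addr_0 -/c2.
    by rewrite -/S; lra.
  rewrite big_seq [leRHS]big_seq; apply: ler_sum => gam gamg.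
  by apply: szego_energy_ge => //; exact: glt.
have eta0 : 0 < h / 16 by rewrite divr_gt0.
(* A second radius, closer to 1, is needed to see that the energy at radius 1 is nearly 1: the loss
   there must be small even compared with h. [S + 1] avoids division by zero. *)
have e2 : 0 < h / 16 / (S + 1) by rewrite divr_gt0 //; lra.
have [rho' rho'01 /andP[h'0 h'le]] := radius _ e2.
have [N HN] := energy_ge rho'01 eta0.
have ncS : ncount <= S by rewrite ler_nat count_size.
pose k := maxn K N; exists k.
have e1 : 1 - h / 8 <= energy alpha k 1.
  have := HN k (leq_maxr _ _).
  have : energy alpha k rho' <= energy alpha k 1.
    rewrite -subr_ge0 energy_sub //; apply: sumr_ge0 => l _.
    rewrite mulr_ge0 ?sqr_ge0 // subr_ge0 exprn_ile1 ?sqr_ge0 //.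
    by rewrite -subr_ge0 ltW.
  have : (1 - rho' ^+ 2) * ncount <= h / 16.
    apply: le_trans (_ : h / 16 / (S + 1) * (S + 1) <= _).
      by apply: ler_pM => //; [exact: ltW | lra].
    by rewrite divfK // gt_eqF //; lra.
  lra.
have r201 : 0 <= rho ^+ 2 <= 1 by rewrite sqr_ge0 /= -subr_ge0 ltW.
have dir : energy alpha k 1 - energy alpha k rho <= h * dirichlet alpha k.
  rewrite energy_sub // mulr_sumr; apply: ler_sum => l _.
  rewrite -mulr_natr mulrCA ler_wpM2l ?sqr_ge0 //.
  by have /andP[] := expr_sub_bounds l r201.
(* In units of h the errors add up to 1/8 + 1/16 + 1/8 = 5/16, which is below 1/2. *)
rewrite -(ltr_pM2l h0); have := up k; have lk := low k (leq_maxl _ _).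
have hlk := ler_wpM2l (ltW h0) lk.
have hhc := ler_wpM2l (ltW h0) hc.
lra.
Qed.

End BlaschkeDirichlet.

(** * Convergence of complex sequences *)

Section ComplexSequences.
Variable R : realType.
Local Notation C := R[i].
Implicit Types (u v : nat -> C) (a b : C).

Definition ccvg u a :=
  ((fun j => complex.Re (u j)) @ \oo --> complex.Re a) /\
  ((fun j => complex.Im (u j)) @ \oo --> complex.Im a).

Lemma ccvg_cst a : ccvg (fun=> a) a.
Proof. by split; exact: cvg_cst. Qed.

Lemma ccvgD u v a b : ccvg u a -> ccvg v b -> ccvg (fun j => u j + v j) (a + b).
Proof.
move=> [ur ui] [vr vi]; split.
- rewrite raddfD; have -> : (fun j => complex.Re (u j + v j)) =
    (fun j => complex.Re (u j) + complex.Re (v j)) by apply/funext => j; rewrite raddfD.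
  exact: cvgD.
- rewrite raddfD; have -> : (fun j => complex.Im (u j + v j)) =
    (fun j => complex.Im (u j) + complex.Im (v j)) by apply/funext => j; rewrite raddfD.
  exact: cvgD.
Qed.

Lemma ReM a b :
  complex.Re (a * b) = complex.Re a * complex.Re b - complex.Im a * complex.Im b.
Proof. by case: a b => ? ? [? ?]. Qed.

Lemma ImM a b :
  complex.Im (a * b) = complex.Re a * complex.Im b + complex.Im a * complex.Re b.
Proof. by case: a b => ? ? [? ?]. Qed.

Lemma ccvgM u v a b : ccvg u a -> ccvg v b -> ccvg (fun j => u j * v j) (a * b).
Proof.
move=> [ur ui] [vr vi]; split.
- rewrite ReM; have -> : (fun j => complex.Re (u j * v j)) = (fun j =>
    complex.Re (u j) * complex.Re (v j) - complex.Im (u j) * complex.Im (v j)).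
    by apply/funext => j; rewrite ReM.
  by apply: cvgB; exact: cvgM.
- rewrite ImM; have -> : (fun j => complex.Im (u j * v j)) = (fun j =>
    complex.Re (u j) * complex.Im (v j) + complex.Im (u j) * complex.Re (v j)).
    by apply/funext => j; rewrite ImM.
  by apply: cvgD; exact: cvgM.
Qed.

Lemma ccvg_normc_sq u a : ccvg u a ->
  (fun j => normc (u j) ^+ 2) @ \oo --> normc a ^+ 2.
Proof.
move=> [ur ui]; rewrite sqr_normcE.
have -> : (fun j => normc (u j) ^+ 2) = (fun j =>
  complex.Re (u j) * complex.Re (u j) + complex.Im (u j) * complex.Im (u j)).
  by apply/funext => j; rewrite sqr_normcE !expr2.
by rewrite !expr2; apply: cvgD; exact: cvgM.
Qed.

Lemma ccvgV u a : a != 0 -> ccvg u a -> ccvg (fun j => (u j)^-1) a^-1.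
Proof.
move=> a0 ua; have na : normc a ^+ 2 != 0 by rewrite expf_eq0 /= normc_eq0.
have [ur ui] := ua.
have ReV (z : C) : complex.Re z^-1 = complex.Re z * (normc z ^+ 2)^-1.
  by case: z => x y; rewrite sqr_normcE.
have ImV (z : C) : complex.Im z^-1 = - complex.Im z * (normc z ^+ 2)^-1.
  by case: z => x y; rewrite sqr_normcE /= mulNr.
have nV : (fun j => (normc (u j) ^+ 2)^-1) @ \oo --> (normc a ^+ 2)^-1.
  exact: cvgV na (ccvg_normc_sq ua).
split.
- rewrite ReV (_ : (fun j => complex.Re (u j)^-1) =
    (fun j => complex.Re (u j) * (normc (u j) ^+ 2)^-1)); first exact: cvgM.
  by apply/funext => j; rewrite ReV.
- rewrite ImV (_ : (fun j => complex.Im (u j)^-1) =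
    (fun j => - complex.Im (u j) * (normc (u j) ^+ 2)^-1)).
    by apply: cvgM => //; exact: cvgN.
  by apply/funext => j; rewrite ImV.
Qed.

Lemma ccvg_horner (P : {poly C}) u a : ccvg u a -> ccvg (fun j => P.[u j]) P.[a].
Proof.
move=> ua; elim/poly_ind: P => [|P c IHP].
  by rewrite horner0; under [X in ccvg X _]eq_fun do rewrite horner0; exact: ccvg_cst.
rewrite hornerD hornerMX hornerC.
under [X in ccvg X _]eq_fun do rewrite hornerD hornerMX hornerC.
by apply: ccvgD (ccvg_cst c); exact: ccvgM.
Qed.

Lemma ccvg_sum (I : Type) (r : seq I) (u : I -> nat -> C) (a : I -> C) :
  (forall i, ccvg (u i) (a i)) ->
  ccvg (fun j => \sum_(i <- r) u i j) (\sum_(i <- r) a i).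
Proof.
move=> ua; elim: r => [|i r IHr].
  by rewrite big_nil; under [X in ccvg X _]eq_fun do rewrite big_nil; exact: ccvg_cst.
rewrite big_cons; under [X in ccvg X _]eq_fun do rewrite big_cons.
exact: ccvgD.
Qed.

Lemma ccvg_dist u a : (forall j, normc (u j - a) <= j.+1%:R^-1) -> ccvg u a.
Proof.
move=> ua; have bound (z : C) : `|complex.Re z| <= normc z /\ `|complex.Im z| <= normc z.
  case: z => x y /=; rewrite -!(sqrtr_sqr x) -(sqrtr_sqr y).
  by rewrite !ler_wsqrtr ?lerDl ?lerDr ?sqr_ge0.
have sq (f : nat -> R) l : (forall j, `|f j - l| <= j.+1%:R^-1) -> f @ \oo --> l.
  move=> fl; apply/cvgrPdist_le => e e0.
  have := @cvg_harmonic R; move=> /cvgr0_norm_le/(_ _ e0)[N _ HN].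
  exists N => // j Nj; have /= := HN j Nj; rewrite /harmonic ger0_norm ?invr_ge0 // distrC.
  exact: le_trans.
split; apply: sq => j; apply: le_trans (ua j); rewrite -raddfB; have [] := bound (u j - a) => //.
Qed.

(** Each coefficient is a rational function of x whose denominator is a power of p(x, 0), so it is
    continuous wherever that value is nonzero, boundary points included. *)
Lemma ccvg_slice_series (P q : {poly {poly C}}) (alpha : nat -> ser C^o)
    (beta : ser C^o) (x : nat -> C) y :
  ccvg x y -> eval2 P y 0 != 0 -> (forall j, eval2 P (x j) 0 != 0) ->
  (forall j, slice P (x j) *: alpha j = ser_of_poly (slice q (x j))) ->
  slice P y *: beta = ser_of_poly (slice q y) ->
  forall l, ccvg (fun j => alpha j l : C) (beta l).
Proof.
move=> xy y0 x0 xP yP l; have [m] := ubnP l; elim: m l => // m IHm l lem.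
have sol (z : C) (c : ser C^o) : eval2 P z 0 != 0 ->
    slice P z *: c = ser_of_poly (slice q z) ->
    (c l : C) = ((q`_l).[z] - \sum_(i < l) (P`_i.+1).[z] * (c (l - i.+1)%N : C)) *
      ((P`_0).[z])^-1.
  rewrite -horner_slice horner_coef0 coef_slice => z0 /(congr1 (fun s : ser C^o => s l)).
  rewrite serZ_recl /ser_of_poly !coef_slice => <-.
  rewrite (eq_bigr (fun i : 'I_l => (P`_i.+1).[z] * (c (l - i.+1)%N : C))).
    by rewrite addrK mulrC mulKf.
  by move=> i _; rewrite coef_slice.
rewrite (sol _ _ y0 yP); under [X in ccvg X _]eq_fun do rewrite (sol _ _ (x0 _) (xP _)).
apply: ccvgM; last first.
  apply: ccvgV; last exact: ccvg_horner.
  by rewrite -coef_slice -horner_coef0 horner_slice.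
have N1 (z : C) : - z = (-1) * z by rewrite mulN1r.
rewrite N1; under [X in ccvg X _]eq_fun do rewrite N1.
apply: ccvgD; first exact: ccvg_horner.
apply: ccvgM; first exact: ccvg_cst.
apply: ccvg_sum => i; apply: ccvgM; first exact: ccvg_horner.
by apply: IHm; have := ltn_ord i; lia.
Qed.

End ComplexSequences.

(** * Polynomials without zeros in the disc *)

Section DiscPolynomials.
Variable R : realType.
Local Notation C := R[i].

(** The [gam] are the inverses of the roots, padded with zeros up to n. A padding zero stands for a
    root at infinity, which reflects to a zero at the origin. *)
Lemma factor_disc (P : {poly C}) n : (size P <= n.+1)%N ->
  (forall z, normc z < 1 -> P.[z] != 0) ->
  exists c (g : seq C), [/\ size g = n, {in g, forall gam, normc gam <= 1} &
    forall z, P.[z] = c * \prod_(gam <- g) (1 - gam * z)].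
Proof.
have [r PE] := closed_field_poly_normal P => sP Pnz.
have P0 : P != 0.
  by apply/negP => /eqP P0; have := Pnz 0; rewrite normc0 P0 horner0 eqxx => /(_ ltr01).
have r1 : {in r, forall b, 1 <= normc b}.
  move=> b br; rewrite leNgt; apply/negP => /Pnz; rewrite PE hornerZ.
  have : root (\prod_(z <- r) ('X - z%:P)) b by rewrite root_prod_XsubC.
  by rewrite /root => /eqP ->; rewrite mulr0 eqxx.
have r0 : {in r, forall b, b != 0}.
  by move=> b /r1 b1; rewrite -normc_gt0 (lt_le_trans ltr01).
have sr : (size r <= n)%N.
  move: sP; rewrite PE size_scale ?lead_coef_eq0 // size_prod_XsubC.
  by rewrite ltnS.
exists (lead_coef P * \prod_(b <- r) - b), ([seq b^-1 | b <- r] ++ nseq (n - size r) 0).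
split.
- by rewrite size_cat size_map size_nseq subnKC.
- move=> gam; rewrite mem_cat => /orP[/mapP[b br ->]|].
    by rewrite normcV invf_le1 ?r1 // (lt_le_trans ltr01) ?r1.
  by rewrite mem_nseq => /andP[_ /eqP ->]; rewrite normc0 ler01.
move=> z; rewrite {1}PE hornerZ horner_prod -mulrA; congr (_ * _).
rewrite big_cat /= [X in _ = _ * (_ * X)]big_seq [X in _ = _ * (_ * X)]big1 ?mulr1; last first.
  by move=> gam; rewrite mem_nseq => /andP[_ /eqP ->]; rewrite mul0r subr0.
rewrite big_map -big_split big_seq [RHS]big_seq; apply: eq_bigr => b br /=.
by rewrite hornerXsubC mulrBr mulr1 mulrA mulNr divff ?r0 // mulN1r opprK addrC.
Qed.

(** The power z^n is shared out among the n factors: z times the conjugate of 1 - gam / conj z is z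
    - conj gam. *)
Lemma reflected_quotient (P Q : {poly C}) n u c (g : seq C) :
  size g = n -> normc u = 1 -> c != 0 ->
  (forall z, P.[z] = c * \prod_(gam <- g) (1 - gam * z)) ->
  (forall z, z != 0 -> Q.[z] = u * z ^+ n * conjc (P.[(conjc z)^-1])) ->
  forall z, z != 0 ->
    normc (Q.[z] / P.[z]) ^+ 2 = \prod_(gam <- g) blaschke_sq gam z.
Proof.
move=> sg u1 c0 PE QE z z0.
have nc0 : normc c != 0 by rewrite normc_eq0.
have key : z ^+ size g * conjc (\prod_(gam <- g) (1 - gam * (conjc z)^-1)) =
    \prod_(gam <- g) (z - conjc gam).
  elim: g {sg PE} => [|gam g IHg]; first by rewrite !big_nil conjc1 mulr1.
  rewrite !big_cons /= exprS rmorphM -IHg mulrACA; congr (_ * _).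
  by rewrite rmorphB rmorphM rmorph1 fmorphV /= conjcK mulrBr mulr1 mulrCA divff // mulr1.
have normc_prod (h : C -> C) : normc (\prod_(gam <- g) h gam) = \prod_(gam <- g) normc (h gam).
  by elim/big_rec2: _ => [|gam a b _ <-]; rewrite ?normc1 // normcM.
have -> : normc (Q.[z] / P.[z]) = \prod_(gam <- g) (normc (z - conjc gam) / normc (1 - gam * z)).
  rewrite normcM normcV QE // !PE rmorphM -sg [conjc c * _]mulrC !mulrA -(mulrA u) key.
  rewrite !normcM u1 mul1r normc_conj invfM -mulrA mulVKf //.
  by rewrite big_split prodfV !normc_prod.
by rewrite /blaschke_sq prodrXl.
Qed.

(** A Harnack type inequality, proved factor by factor from |1 - gam z1| <= |1 - gam z0| + 2 and |1
    - gam z0| >= 1 - |z0|. The constant depends on n and z0 only, so it survives limits of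
    polynomials. *)
Lemma disc_comparison (P : {poly C}) n z0 z1 : (size P <= n.+1)%N ->
  (forall z, normc z < 1 -> P.[z] != 0) -> normc z0 < 1 -> normc z1 < 1 ->
  normc P.[z1] <= (1 + 2 / (1 - normc z0)) ^+ n * normc P.[z0].
Proof.
move=> sP Pnz z01 z11; have [c [g [<- g1 PE]]] := factor_disc sP Pnz.
rewrite !PE !normcM mulrCA ler_wpM2l ?normc_ge0 //.
have d0 : 0 < 1 - normc z0 by rewrite subr_gt0.
set K := 1 + _; have K0 : 0 <= K by rewrite addr_ge0 // divr_ge0 // ltW.
elim: g g1 {PE} => [|gam g IHg] g1; first by rewrite !big_nil mul1r.
rewrite !big_cons /= exprS !normcM mulrACA.
have /IHg IH : {in g, forall gam, normc gam <= 1}.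
  by move=> x xg; apply: g1; rewrite inE xg orbT.
apply: ler_pM; rewrite ?normc_ge0 //.
have gg := g1 gam (mem_head _ _).
have A : 1 - normc z0 <= normc (1 - gam * z0).
  apply: le_trans (ler_normcB _ _); rewrite normc1 normcM lerB // ler_piMl ?normc_ge0 //.
rewrite mulrDl mul1r.
have -> : 1 - gam * z1 = (1 - gam * z0) + gam * (z0 - z1) by ring.
apply: le_trans (ler_normcD _ _) _; rewrite lerD2l.
apply: le_trans (_ : 2 <= _).
  rewrite normcM -[leRHS]mul1r ler_pM ?normc_ge0 //.
  by apply: le_trans (ler_normcD _ _) _; rewrite normc_opp; lra.
by rewrite mulrAC ler_pdivlMr // ler_pM2l.
Qed.

Lemma poly_eq0_on_disc (P : {poly C}) : (forall z, normc z < 1 -> P.[z] = 0) -> P = 0.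
Proof.
move=> P0; apply: contrapT => /eqP Pn0.
pose w i : C := ((i.+2%:R^-1 : R)%:C)%C.
have w_inj : injective w.
  by move=> i j [/invr_inj/eqP]; rewrite eqr_nat => /eqP [].
have := max_poly_roots Pn0 (rs := map w (iota 0 (size P))).
rewrite size_map size_iota ltnn map_inj_uniq // iota_uniq => H.
suff : false by [].
apply: H => //.
apply/allP => _ /mapP[i _ ->]; rewrite /root P0 //.
by rewrite normc_real ?invr_ge0 // invf_lt1 // ltr1n.
Qed.

Lemma radial_sequence (x : C) : normc x <= 1 ->
  exists y : nat -> C, (forall j, normc (y j) < 1) /\ ccvg y x.
Proof.
move=> x1; pose y j : C := ((1 - j.+2%:R^-1 : R)%:C)%C * x.
have t01 j : 0 <= (1 - j.+2%:R^-1 : R) < 1.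
  have : 0 < j.+2%:R^-1 :> R by rewrite invr_gt0.
  have : j.+2%:R^-1 <= 1 :> R by rewrite invf_le1 // ler1n.
  by move: (j.+2%:R^-1) => q; lra.
have y1 j : normc (y j) < 1.
  have /andP[a0 a1] := t01 j.
  rewrite normcM normc_real //; apply: le_lt_trans a1.
  by rewrite ler_piMr.
have yx : ccvg y x.
  apply: ccvg_dist => j; have -> : y j - x = - ((j.+2%:R^-1 : R)%:C)%C * x.
    by rewrite /y rmorphB rmorph1; ring.
  rewrite normcM normc_opp normc_real ?invr_ge0 //.
  apply: le_trans (_ : j.+2%:R^-1 * 1 <= _); first by rewrite ler_wpM2l ?invr_ge0.
  by rewrite mulr1 lef_pV2 ?posrE // ler_nat.
by exists y.
Qed.

(* A Hurwitz type argument: zeros cannot enter the disc in the limit unless the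
   limit vanishes identically. *)
Lemma slice_zero_free (P : {poly {poly C}}) x :
  (forall x z, normc x < 1 -> normc z < 1 -> eval2 P x z != 0) ->
  normc x <= 1 -> slice P x != 0 ->
  forall z, normc z < 1 -> eval2 P x z != 0.
Proof.
move=> Pnz x1 Px z0 z01; apply/negP => /eqP Pz0.
apply/negP: Px; rewrite negbK; apply/eqP; apply: poly_eq0_on_disc => z z1.
have [y [y1 yx]] := radial_sequence x1.
have cmp j : normc (eval2 P (y j) z) ^+ 2 <=
    ((1 + 2 / (1 - normc z0)) ^+ (size P)) ^+ 2 * normc (eval2 P (y j) z0) ^+ 2.
  rewrite -exprMn lerXn2r ?nnegrE ?normc_ge0 ?mulr_ge0 ?normc_ge0 ?exprn_ge0 //.
    by rewrite addr_ge0 // divr_ge0 // subr_ge0 ltW.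
  rewrite -!horner_slice; apply: disc_comparison => //.
    by apply: leq_trans (leqnSn _); exact: size_poly.
  by move=> w w1; rewrite horner_slice Pnz.
have c1 := ccvg_normc_sq (ccvg_horner P.[z%:P] yx).
have c2 := ccvg_normc_sq (ccvg_horner P.[z0%:P] yx).
set K := ((1 + 2 / (1 - normc z0)) ^+ (size P)) ^+ 2 in cmp.
have c3 : (fun j => K * normc (P.[z0%:P]).[y j] ^+ 2) @ \oo --> K * normc (P.[z0%:P]).[x] ^+ 2.
  by apply: cvgM c2; exact: cvg_cst.
have := ler_cvg_to c1 c3 (nearW _ cmp).
rewrite -/(eval2 P x z0) Pz0 normc0 expr0n mulr0 -/(eval2 P x z) => le0.
apply/eqP; rewrite horner_slice -normc_eq0 -sqrf_eq0 eq_le le0 sqr_ge0 //.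
Qed.

Lemma circle_points (x : C) (s : seq C) (d : R) : normc x = 1 -> 0 < d ->
  exists y, [/\ normc y = 1, normc (y - x) <= d & y \notin s].
Proof.
move=> x1 d0.
pose t i : R := d / 2 * i.+1%:R^-1.
have t0 i : 0 < t i by rewrite mulr_gt0 ?divr_gt0 ?invr_gt0.
(* The Cayley transform gives infinitely many distinct points of the circle near [x], at distance at
   most 2 t from it. *)
pose w i : C := x * ((1 +i* t i)%C / (1 -i* t i)%C).
have nz (r : R) : (1 +i* r)%C != 0 :> C.
  by rewrite eq_complex /= oner_eq0.
have w_inj : injective w.
  move=> i j; have x0 : x != 0 by rewrite -normc_gt0 x1 ltr01.
  move=> /(mulfI x0)/eqP; rewrite eqr_div ?nz // => /eqP; simpc => -[_].
  move=> E; have {}E : t i = t j by lra.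
  move: E; rewrite /t => /mulfI E.
  have /E/invr_inj/eqP : d / 2 != 0 by rewrite gt_eqF // divr_gt0.
  by rewrite eqr_nat => /eqP [].
have nw i : normc (w i) = 1.
  by rewrite normcM x1 mul1r normcM normcV /= sqrrN divff // gt_eqF // sqrtr_gt0 expr1n ltr_wpDr ?sqr_ge0.
have dw i : normc (w i - x) <= d.
  have -> : w i - x = x * ((0 +i* (2 * t i))%C / (1 -i* t i)%C).
    apply: (mulIf (nz (- t i))); rewrite mulrBl /w -!mulrA !mulVf ?nz // !mulr1.
    rewrite -mulrBr; congr (x * _); simpc; congr (_ +i* _)%C; ring.
  rewrite normcM x1 mul1r normcM normcV ler_pdivrMr ?normc_gt0 ?nz //.
  apply: le_trans (_ : d * 1 <= _).
    have ti : 2 * t i <= d.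
      have -> : 2 * t i = d * i.+1%:R^-1 by rewrite /t mulrA (mulrC 2) divfK.
      by apply: ler_piMr; [exact: ltW|rewrite invf_le1 // ler1n].
    have t20 : 0 <= 2 * t i by rewrite mulr_ge0 // ltW.
    by rewrite mulr1 /= expr0n add0r sqrtr_sqr ger0_norm.
  rewrite ler_pM2l // /= -[leLHS]sqrtr1 ler_wsqrtr // expr1n lerDl sqr_ge0 //.
apply: contrapT => H.
have all_in i : w i \in s.
  by apply: contrapT => /negP ws; apply: H; exists (w i).
have : (size (map w (iota 0 (size s).+1)) <= size s)%N.
  apply: uniq_leq_size; first by rewrite map_inj_uniq // iota_uniq.
  by move=> _ /mapP[i _ ->].
by rewrite size_map size_iota ltnn.
Qed.

End DiscPolynomials.

(** * From H^2 bounds to coefficient bounds *)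

Section CoefficientEstimates.
Variable R : realType.
Local Notation C := R[i].

Lemma weighted_cauchy_schwarz (w a : nat -> R) n : (forall k, 0 < w k) ->
  (\sum_(k < n) a k) ^+ 2 <= (\sum_(k < n) (w k)^-1) * \sum_(k < n) w k * a k ^+ 2.
Proof.
move=> w0; elim: n => [|n IHn]; first by rewrite !big_ord0 mul0r expr0n.
rewrite !big_ord_recr /=.
set A := \sum_(k < n) a k in IHn *; set S := \sum_(k < n) (w k)^-1 in IHn *.
set Q := \sum_(k < n) w k * a k ^+ 2 in IHn *.
have S0 : 0 <= S.
  by apply: sumr_ge0 => k _; rewrite invr_ge0 ltW.
have Q0 : 0 <= Q.
  by apply: sumr_ge0 => k _; rewrite mulr_ge0 ?sqr_ge0 // ltW.
move: A S Q IHn S0 Q0 => A S Q AS S0 Q0.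
have wn := w0 n; move: (w n) (a n) wn => v b v0.
have vV : v * v^-1 = 1 by rewrite divff // gt_eqF.
have -> : (S + v^-1) * (Q + v * b ^+ 2) =
    S * Q + (S * v * b ^+ 2 + Q * v^-1) + v * v^-1 * b ^+ 2 by ring.
rewrite vV mul1r sqrrD lerD2r lerD //.
have sq : A ^+ 2 <= (S * v) * (Q * v^-1).
  by rewrite mulrACA vV mulr1.
have s0 : 0 <= S * v by rewrite mulr_ge0 // ltW.
have q0 : 0 <= Q * v^-1 by rewrite mulr_ge0 // invr_ge0 ltW.
move: (S * v) (Q * v^-1) s0 q0 sq => s q s0 q0 sq.
have [s_0|s_n0] := eqVneq s 0.
  have A0 : A = 0.
    by apply/eqP; rewrite -sqrf_eq0 eq_le sqr_ge0 andbT; move: sq; rewrite s_0 mul0r.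
  by rewrite A0 s_0; lra.
have sp : 0 < s by rewrite lt_neqAle eq_sym s_n0.
rewrite -(ler_pM2l sp); have := sqr_ge0 (s * b - A); nra.
Qed.

(** Telescoping: for l >= 1, (l + k)(l + k + 1) <= 2 (l + k)^2 <= 4 (k^2 + l^2), hence the constant
    4. *)
Lemma inverse_square_sum (l : nat) n : (0 < l)%N ->
  l%:R * (\sum_(k < n) (k%:R ^+ 2 + l%:R ^+ 2)^-1) <= 4 :> R.
Proof.
move=> l0; have lp : 0 < l%:R :> R by rewrite ltr0n.
have l1 : 1 <= l%:R :> R by rewrite ler1n.
suff H : \sum_(k < n) (k%:R ^+ 2 + l%:R ^+ 2)^-1 <= 4 / l%:R - 4 / (l%:R + n%:R) :> R.
  rewrite mulrC -ler_pdivlMr //; apply: le_trans H _; rewrite gerBl.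
  by apply: divr_ge0 => //; exact: addr_ge0.
elim: n => [|n IHn]; first by rewrite big_ord0 addr0 subrr.
rewrite big_ord_recr /= -[n.+1%:R]natr1; have n0 : 0 <= n%:R :> R by [].
move: (n%:R : R) (l%:R : R) n0 lp l1 IHn => N L N0 L0 L1 IHn.
have step : (N ^+ 2 + L ^+ 2)^-1 <= 4 / (L + N) - 4 / (L + (N + 1)).
  have -> : 4 / (L + N) - 4 / (L + (N + 1)) = 4 / ((L + N) * (L + (N + 1))).
    by field; rewrite !gt_eqF //; lra.
  rewrite ler_pdivlMr; last by rewrite mulr_gt0 //; lra.
  rewrite mulrC ler_pdivrMr; last by nra.
  have : 0 <= (N - L) ^+ 2 by exact: sqr_ge0.
  have : 1 * (L + N) <= (L + N) * (L + N) by rewrite ler_pM2r; lra.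
  lra.
by apply: le_trans (lerD IHn step) _; rewrite addrA subrK.
Qed.

Lemma pser_value_bound (b : ser C^o) (F : C -> C) l c x : (0 < l)%N ->
  pser b F ->
  (forall n, \sum_(k < n) (k%:R ^+ 2 + l%:R ^+ 2) * normc (b k) ^+ 2 <= c) ->
  normc x < 1 -> l%:R * normc (F x) ^+ 2 <= 4 * c.
Proof.
move=> l0 bF bc x1; apply/ler_addgt0Pr => eta eta0.
have lp : 0 < l%:R :> R by rewrite ltr0n.
have [rho rho01 xr] : exists2 rho, 0 < rho < 1 & normc x <= rho.
  by exists ((1 + normc x) / 2); have := normc_ge0 x; lra.
have e0 : 0 < eta / l%:R by rewrite divr_gt0.
have [N HN] := pser_sq_approx bF rho01 e0.
have := HN N (leqnn _) x xr; rewrite ler_norml => /andP[_ up].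
have ps : normc (psum b N x) <= \sum_(k < N) normc (b k).
  apply: le_trans (ler_normc_sum _ _) _; apply: ler_sum => k _.
  by rewrite normcM normcX ler_piMr ?normc_ge0 // exprn_ile1 ?normc_ge0 // ltW.
have w0 (k : nat) : 0 < k%:R ^+ 2 + l%:R ^+ 2 :> R.
  by rewrite ltr_wpDl ?sqr_ge0 // exprn_gt0.
have cs := weighted_cauchy_schwarz (fun k => normc (b k)) N w0.
have isum := inverse_square_sum N l0.
have S0 : 0 <= \sum_(k < N) (k%:R ^+ 2 + l%:R ^+ 2)^-1 :> R.
  by apply: sumr_ge0 => k _; rewrite invr_ge0 ltW.
have Q0 : 0 <= \sum_(k < N) (k%:R ^+ 2 + l%:R ^+ 2) * normc (b k) ^+ 2.
  by apply: sumr_ge0 => k _; rewrite mulr_ge0 ?sqr_ge0 // ltW.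
have psq : normc (psum b N x) ^+ 2 <= (\sum_(k < N) normc (b k)) ^+ 2.
  rewrite lerXn2r ?nnegrE ?normc_ge0 // sumr_ge0 // => k _; exact: normc_ge0.
have up' : normc (F x) ^+ 2 <= eta / l%:R + (\sum_(k < N) normc (b k)) ^+ 2 by lra.
apply: le_trans (ler_wpM2l (ltW lp) up') _.
rewrite mulrDr mulrC divfK ?gt_eqF // addrC lerD2r.
apply: le_trans (ler_wpM2l (ltW lp) cs) _; rewrite mulrA.
by apply: ler_pM => //; rewrite mulr_ge0 // ltW.
Qed.

Lemma eval2M (P Q : {poly {poly C}}) x z : eval2 (P * Q) x z = eval2 P x z * eval2 Q x z.
Proof. by rewrite /eval2 !hornerM. Qed.

Lemma eval2B (P Q : {poly {poly C}}) x z : eval2 (P - Q) x z = eval2 P x z - eval2 Q x z.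
Proof. by rewrite /eval2 hornerD hornerN hornerD hornerN. Qed.

Lemma eval2_X (x z : C) : eval2 'X x z = z.
Proof. by rewrite /eval2 hornerX hornerC. Qed.

Lemma eval2_XC (x z : C) : eval2 'X%:P x z = x.
Proof. by rewrite /eval2 hornerC hornerX. Qed.

Lemma euler_quotient2 (p q : {poly {poly C}}) (A : ser (ser C^o)) :
  p *: A = ser2_of_poly q ->
  (p * p) *: ser_euler A = ser2_of_poly (p * ('X * dz2 q) - ('X * dz2 p) * q).
Proof.
move=> pA; have comm (X : {poly {poly C}}) : p *: (X *: A) = ser2_of_poly (X * q).
  by rewrite scalerA mulrC -scalerA pA ser2_of_polyM.
by rewrite -scalerA ser_euler_leibniz scalerBr pA ser2_euler_of_poly -ser2_of_polyM comm -ser2_of_polyB.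
Qed.

Lemma euler_quotient1 (p q : {poly {poly C}}) (A : ser (ser C^o)) :
  p *: A = ser2_of_poly q ->
  (p * p) *: inner_euler A = ser2_of_poly (p * ('X%:P * dz1 q) - ('X%:P * dz1 p) * q).
Proof.
move=> pA; have comm (X : {poly {poly C}}) : p *: (X *: A) = ser2_of_poly (X * q).
  by rewrite scalerA mulrC -scalerA pA ser2_of_polyM.
by rewrite -scalerA inner_euler_leibniz scalerBr pA inner_euler_of_poly -ser2_of_polyM comm -ser2_of_polyB.
Qed.

(** [f] only has to dominate the quotient: the Euler operators produce z_i times the partial
    derivative, while the H^2 hypothesis is about the derivative itself. *)
Lemma H2_coefficients (P q : {poly {poly C}}) (B : ser (ser C^o)) (f : C -> C -> C) :
  (forall x z, normc x < 1 -> normc z < 1 -> eval2 P x z != 0) ->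
  P *: B = ser2_of_poly q ->
  (forall x z, normc x < 1 -> normc z < 1 ->
    normc (eval2 q x z / eval2 P x z) <= normc (f x z)) ->
  in_H2_bidisc f ->
  exists M, forall L K, \sum_(l < L) \sum_(k < K) normc (B l k) ^+ 2 <= M.
Proof.
move=> Pnz PB qf [M fM]; exists M => L K.
pose p : {poly R} := \sum_(l < L) \sum_(k < K) (normc (B l k) ^+ 2) *: 'X^((k + l) * 2).
have pE rho : p.[rho] = \sum_(l < L) \sum_(k < K) (normc (B l k) * rho ^+ k * rho ^+ l) ^+ 2.
  rewrite horner_sum; apply: eq_bigr => l _; rewrite horner_sum; apply: eq_bigr => k _.
  by rewrite hornerZ hornerXn -mulrA -exprD exprMn -exprM.
have -> : \sum_(l < L) \sum_(k < K) normc (B l k) ^+ 2 = p.[1].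
  by rewrite pE; apply: eq_bigr => l _; apply: eq_bigr => k _; rewrite !expr1n !mulr1.
apply: horner_le_at1 => rho rho01; rewrite pE -lee_fin.
have /andP[_ rho1] := rho01.
apply: le_trans (fM _ rho01); apply: double_bessel PB rho01 _ _ _ => // x z xr zr.
by apply: qf; rewrite ?xr ?zr.
Qed.

Lemma normc_mulrn (z : C) k : normc (z *+ k) = k%:R * normc z.
Proof.
rewrite -[z *+ k]mulr_natl normcM; congr (_ * _).
by rewrite -[k%:R in LHS](rmorph_nat (real_complex R)) normc_real.
Qed.

Lemma H2_gradient_coefficients (p q : {poly {poly C}}) (A : ser (ser C^o)) :
  (forall x z, normc x < 1 -> normc z < 1 -> eval2 p x z != 0) ->
  p *: A = ser2_of_poly q ->
  in_H2_bidisc (fun x z => (eval2 (dz1 q) x z * eval2 p x z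
     - eval2 q x z * eval2 (dz1 p) x z) / (eval2 p x z) ^+ 2) ->
  in_H2_bidisc (fun x z => (eval2 (dz2 q) x z * eval2 p x z
     - eval2 q x z * eval2 (dz2 p) x z) / (eval2 p x z) ^+ 2) ->
  exists M, forall L K, \sum_(l < L) \sum_(k < K)
    (k%:R ^+ 2 + l%:R ^+ 2) * normc (A l k) ^+ 2 <= M.
Proof.
move=> pnz pA f1 f2.
have ppnz x z : normc x < 1 -> normc z < 1 -> eval2 (p * p) x z != 0.
  by move=> x1 z1; rewrite eval2M mulf_neq0 // pnz.
have [|M1 H1] := H2_coefficients ppnz (euler_quotient1 pA) _ f1.
  move=> x z x1 z1; rewrite eval2B !eval2M eval2_XC -expr2.
  rewrite (_ : _ - _ = x * (eval2 (dz1 q) x z * eval2 p x z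
     - eval2 q x z * eval2 (dz1 p) x z)); last by ring.
  by rewrite -mulrA normcM ler_piMl ?normc_ge0 // ltW.
have [|M2 H2] := H2_coefficients ppnz (euler_quotient2 pA) _ f2.
  move=> x z x1 z1; rewrite eval2B !eval2M eval2_X -expr2.
  rewrite (_ : _ - _ = z * (eval2 (dz2 q) x z * eval2 p x z
     - eval2 q x z * eval2 (dz2 p) x z)); last by ring.
  by rewrite -mulrA normcM ler_piMl ?normc_ge0 // ltW.
exists (M1 + M2) => L K; apply: le_trans (lerD (H1 L K) (H2 L K)).
rewrite -big_split; apply: ler_sum => l _ /=; rewrite -big_split; apply: ler_sum => k _ /=.
rewrite /inner_euler /ser_euler serMnE !normc_mulrn !exprMn -mulrDl //.
Qed.

End CoefficientEstimates.

Lemma cvg_sumr (R : realType) (I : Type) (r : seq I) (u : I -> nat -> R) (a : I -> R) :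
  (forall i, u i @ \oo --> a i) ->
  (fun j => \sum_(i <- r) u i j) @ \oo --> \sum_(i <- r) a i.
Proof.
move=> ua; elim: r => [|i r IHr].
  rewrite big_nil (_ : (fun j => _) = fun=> 0); first exact: cvg_cst.
  by apply/funext => j; rewrite big_nil.
rewrite big_cons (_ : (fun j => _) = fun j => u i j + \sum_(i <- r) u i j).
  by apply: cvgD.
by apply/funext => j; rewrite big_cons.
Qed.

(** Supplies the majorants [c] for a Weierstrass test: [c l] is the full row sum, and the row sums
    form a convergent series. *)
Lemma double_sum_tail (R : realType) (f : nat -> nat -> R) (M : R) :
  (forall l k, 0 <= f l k) ->
  (forall L K, \sum_(l < L) \sum_(k < K) f l k <= M) ->
  exists c : nat -> R, (forall l K, \sum_(k < K) f l k <= c l) /\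
    (forall eta, 0 < eta -> exists L0, forall L, \sum_(L0 <= l < L) c l <= eta).
Proof.
move=> f0 fM.
pose s l K := \sum_(k < K) f l k.
have snd l : nondecreasing_seq (s l).
  move=> m n mn; rewrite /s -(subnKC mn) big_split_ord /= lerDl.
  by apply: sumr_ge0 => k _; exact: f0.
have sle l K : s l K <= M.
  apply: le_trans (fM l.+1 K); rewrite big_ord_recr /= lerDr.
  by apply: sumr_ge0 => i _; apply: sumr_ge0 => k _; exact: f0.
have scvg l : cvgn (s l).
  by apply: nondecreasing_is_cvgn => //; exists M => _ [K _ <-]; exact: sle.
pose c l := limn (s l).
have sc l K : s l K <= c l by exact: nondecreasing_cvgn_le.
have c0 l : 0 <= c l by apply: le_trans (sc l 0%N); rewrite /s big_ord0.
exists c; split=> // eta eta0.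
pose S L := \sum_(0 <= l < L) c l.
have SM L : S L <= M.
  have cv : (fun K => \sum_(0 <= l < L) s l K) @ \oo --> S L.
    by apply: cvg_sumr => l; exact: scvg.
  have le_M K : \sum_(0 <= l < L) s l K <= M by rewrite big_mkord; exact: fM.
  exact: (ler_cvg_to cv (cvg_cst M) (nearW _ le_M)).
have Snd : nondecreasing_seq S.
  move=> m n mn; rewrite /S (@big_cat_nat _ _ _ m 0 n) //= lerDl.
  by apply: sumr_ge0 => l _; exact: c0.
have Scvg : cvgn S.
  by apply: nondecreasing_is_cvgn => //; exists M => _ [K _ <-]; exact: SM.
have /cvgrPdist_le/(_ _ eta0)[L0 _ HL] := Scvg.
exists L0 => L; have [L0L|/ltnW LL0] := leqP L0 L; last first.
  by rewrite big_geq // ltW.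
have := HL L0 (leqnn _); rewrite /= ger0_norm ?subr_ge0; last exact: nondecreasing_cvgn_le.
have : S L <= limn S by exact: nondecreasing_cvgn_le.
rewrite {1}/S (@big_cat_nat _ _ _ L0 0 L) //= -/(S L0); lra.
Qed.

(** * The jump of the zero count contradicts continuity *)

Theorem theorem6p2 (R : realType) (m n : nat)
    (p ptilde : {poly {poly R[i]}}) :
  (1 <= m * n)%N ->
  has_bidegree p m n ->
  (* p has no zeros in the open bidisc D^2 *)
  (forall z1 z2 : R[i], `|z1| < 1 -> `|z2| < 1 -> eval2 p z1 z2 != 0) ->
  (* ptilde(z) = z1^m z2^n conj(p(1/conj z1, 1/conj z2)) *)
  (forall z1 z2 : R[i], z1 != 0 -> z2 != 0 ->
     eval2 ptilde z1 z2
     = z1 ^+ m * z2 ^+ n * conjc (eval2 p (conjc z1)^-1 (conjc z2)^-1)) ->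
  (* atoral: no common factor *)
  ~ common_factor p ptilde ->
  NT2 ptilde p (2 * m * n) ->
  (* d phi/dz1 = (dptilde/dz1 p - ptilde dp/dz1)/p^2, same for z2 *)
  ~ in_H2_bidisc (fun z1 z2 : R[i] =>
       (eval2 (dz1 ptilde) z1 z2 * eval2 p z1 z2
        - eval2 ptilde z1 z2 * eval2 (dz1 p) z1 z2) / (eval2 p z1 z2) ^+ 2)
  \/
  ~ in_H2_bidisc (fun z1 z2 : R[i] =>
       (eval2 (dz2 ptilde) z1 z2 * eval2 p z1 z2
        - eval2 ptilde z1 z2 * eval2 (dz2 p) z1 z2) / (eval2 p z1 z2) ^+ 2).
Proof.
move=> mn1 [_ [_ degp]] pnz0 refl0 _ [s [mult [_ [smem [_ smn]]]]].
apply/not_andP => -[f1 f2].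
have pnz x z : normc x < 1 -> normc z < 1 -> eval2 p x z != 0.
  by rewrite -!normr_lt1; exact: pnz0.
have sizep : (size p <= n.+1)%N by move: degp; rewrite /deg_z2; lia.
have conjV (x : R[i]) : normc x = 1 -> (conjc x)^-1 = x.
  move=> x1; have xx : x * conjc x = 1 by rewrite -sqr_normcC x1 expr1n.
  by rewrite -[LHS]mul1r -xx mulfK // conjc_eq0 -normc_eq0 x1 oner_eq0.
have nz1 (x : R[i]) : normc x = 1 -> x != 0 by rewrite -normc_eq0 => ->; rewrite oner_eq0.
have refl x z : normc x = 1 -> z != 0 ->
    eval2 ptilde x z = x ^+ m * z ^+ n * conjc (eval2 p x (conjc z)^-1).
  by move=> x1 z0; rewrite refl0 ?(nz1 x) // conjV.
have in_s x z : normc x = 1 -> normc z = 1 -> eval2 p x z = 0 -> (x, z) \in s.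
  move=> x1 z1 pz; apply/smem; split; last split=> //=.
    by split; apply/normr_eq1.
  by rewrite refl ?nz1 // conjV // pz conjc0 mulr0.
have [[lam1 lam2] lams] : exists l, l \in s.
  case: (s) smn => [|l s' _]; last by exists l; exact: mem_head.
  by rewrite big_nil; move: mn1; lia.
have [[/normr_eq1/= l1 /normr_eq1/= l2] [_ /= plam]] := (smem _).1 lams.
(* If p(x, .) vanished identically, every point of the circle above x would give a common zero, but
   [s] is finite. *)
have slice_nz x : normc x = 1 -> slice p x != 0.
  move=> x1; apply/eqP => px0.
  have [y [y1 _ /negP]] := circle_points (map snd s) (normc1 R) ltr01.
  apply; apply/mapP; exists (x, y) => //; apply: in_s => //.
  by rewrite -horner_slice px0 horner0.
have pnz1 x z : normc x <= 1 -> normc z < 1 -> eval2 p x z != 0.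
  rewrite le_eqVlt => /orP[/eqP x1|x1]; last exact: pnz.
  by apply: slice_zero_free => //; rewrite ?x1 // slice_nz.
have p00 x : normc x <= 1 -> eval2 p x 0 != 0.
  by move=> x1; apply: pnz1; rewrite ?normc0.
have /choice[alpha alphaP] : forall x, exists a : ser R[i]^o, normc x <= 1 ->
    slice p x *: a = ser_of_poly (slice ptilde x).
  move=> x; have [x1|x1] := boolP (normc x <= 1); last by exists 0.
  by have [a aP] := slice_series ptilde (p00 x x1); exists a.
have alpha_ser x : normc x <= 1 ->
    pser (alpha x) (fun z => (slice ptilde x).[z] / (slice p x).[z]).
  move=> x1; have := pser_of_poly (slice ptilde x).
  rewrite -alphaP // => /(pser_div (D := slice p x)); apply.
  by move=> z z1; rewrite horner_slice pnz1.
have [A pA] : exists A, p *: A = ser2_of_poly ptilde.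
  apply: (@ser_divisible _ (ser R[i]^o)) => b.
  apply: (@ser_divisible _ R[i]^o) => v; exists (((p`_0)`_0)^-1 * v).
  rewrite [_ *: _]mulrA divff ?mul1r // -horner_coef0 -coef_slice -horner_coef0.
  by rewrite horner_slice p00 // normc0.
have A_ser l : pser (A l) (fun x => alpha x l).
  apply: double_pser pA _ l => x x1; last by apply: alphaP; exact: ltW.
  by rewrite -coef_slice -horner_coef0 horner_slice p00 // ltW.
have [M HM] := H2_gradient_coefficients pnz pA f1 f2.
have [|c [cA ctail]] := double_sum_tail
    (f := fun l k => (k%:R ^+ 2 + l%:R ^+ 2) * normc (A l k) ^+ 2) _ HM.
  by move=> l k; rewrite mulr_ge0 ?addr_ge0 ?sqr_ge0.
have cvg_alpha x (y : nat -> R[i]) : normc x <= 1 -> (forall j, normc (y j) <= 1) ->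
    ccvg y x -> forall l, ccvg (fun j => alpha (y j) l : R[i]) (alpha x l).
  move=> x1 y1 yx; apply: (ccvg_slice_series yx) => [|j|j|].
  - exact: p00.
  - exact: p00.
  - exact: alphaP.
  - exact: alphaP.
have bound x l : normc x <= 1 -> l%:R * normc (alpha x l) ^+ 2 <= 4 * c l.
  have [->|l0] := posnP l.
    move=> _; rewrite mul0r mulr_ge0 //; apply: le_trans (cA 0%N 0%N).
    by rewrite big_ord0.
  have inner y : normc y < 1 -> l%:R * normc (alpha y l) ^+ 2 <= 4 * c l.
    by move=> y1; apply: (pser_value_bound l0 (A_ser l) (cA l) y1).
  move=> x1; have [y [y1 yx]] := radial_sequence x1.
  have cv := ccvg_normc_sq (cvg_alpha x y x1 (fun j => ltW (y1 j)) yx l).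
  have cl : (fun j => l%:R * normc (alpha (y j) l) ^+ 2) @ \oo -->
      l%:R * normc (alpha x l) ^+ 2.
    by apply: cvgM cv; exact: cvg_cst.
  exact: (ler_cvg_to cl (cvg_cst (4 * c l)) (nearW _ (fun j => inner _ (y1 j)))).
(* The terms are bounded by [4 * c l], so the tail beyond [L0] contributes at most 4/32 = 1/8,
   uniformly on the closed disc. *)
have e32 : 0 < 1 / 32 :> R by lra.
have [L0 HL0] := ctail _ e32.
have dirE (a : ser R[i]^o) L : dirichlet a L = \sum_(0 <= l < L) l%:R * normc (a l) ^+ 2.
  by rewrite big_mkord; apply: eq_bigr => l _; rewrite mulr_natl.
have dir_tail x L : normc x <= 1 -> dirichlet (alpha x) L <= dirichlet (alpha x) L0 + 1 / 8.
  move=> x1; rewrite !dirE.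
  have pos a b : 0 <= \sum_(a <= l < b) l%:R * normc (alpha x l) ^+ 2.
    by apply: sumr_ge0 => l _; rewrite mulr_ge0 ?sqr_ge0.
  have [L0L|/ltnW LL0] := leqP L0 L; last first.
    by rewrite (@big_cat_nat _ _ _ L 0 L0) //= -addrA lerDl addr_ge0 //; lra.
  rewrite (@big_cat_nat _ _ _ L0 0 L) //= lerD2l.
  apply: le_trans (_ : \sum_(L0 <= l < L) 4 * c l <= _).
    by apply: ler_sum => l _; exact: bound.
  by rewrite -mulr_sumr; have := HL0 L; lra.
have blaschke x : normc x = 1 -> exists g : seq R[i], [/\ size g = n,
    {in g, forall gam, normc gam <= 1},
    forall z, eval2 p x z = 0 -> exists2 gam, gam \in g & gam * z = 1,
    {in g, forall gam, normc gam = 1 -> eval2 p x gam^-1 = 0} &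
    forall z, 0 < normc z < 1 -> normc ((slice ptilde x).[z] / (slice p x).[z]) ^+ 2 =
      \prod_(gam <- g) blaschke_sq gam z].
  move=> x1; have x1' : normc x <= 1 by rewrite x1.
  have sz : (size (slice p x) <= n.+1)%N by apply: leq_trans sizep; exact: size_poly.
  have [|d [g [sg g1 pE]]] := factor_disc sz.
    by move=> z z1; rewrite horner_slice pnz1.
  have d0 : d != 0.
    apply/negP => /eqP d0; have := p00 x x1'.
    by rewrite -horner_slice pE d0 mul0r eqxx.
  exists g; split=> //.
  - move=> z; rewrite -horner_slice pE => /eqP; rewrite mulf_eq0 (negbTE d0) /=.
    rewrite prodf_seq_eq0 => /hasP[gam gamg /=]; rewrite subr_eq0 => /eqP e.
    by exists gam.
  - move=> gam gamg gam1; rewrite -horner_slice pE; apply/eqP; rewrite mulf_eq0.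
    rewrite prodf_seq_eq0; apply/orP; right; apply/hasP; exists gam => //=.
    by rewrite divff ?subrr // nz1.
  move=> z /andP[z0 _].
  apply: (reflected_quotient sg (u := x ^+ m) _ d0 pE); last by rewrite -normc_gt0.
    by rewrite normcX x1 expr1n.
  by move=> w w0; rewrite !horner_slice refl.
have low L : dirichlet (alpha lam1) L <= n%:R - 1.
  have [g [sg g1 zero_g _ phiE]] := blaschke _ l1.
  have l1' : normc lam1 <= 1 by rewrite l1.
  apply: le_trans (blaschke_dirichlet_le (alpha_ser _ l1') g1 phiE L) _.
  (* The zero [lam2] on the circle forces a [gam] of modulus one, which the count of zeros in the
     open disc misses. *)
  have [gam gamg e] := zero_g _ plam.
  have gam1 : normc gam = 1.
    by have := congr1 (@normc R) e; rewrite normcM l2 mulr1 normc1.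
  rewrite -sg -(count_predC (fun gam => (normc gam < 1)%R) g) natrD lerBrDr lerD2l.
  by rewrite ler1n -has_count; apply/hasP; exists gam; rewrite //= gam1 ltxx.
have /choice[y yP] : forall j, exists y : R[i], [/\ normc y = 1,
    normc (y - lam1) <= j.+1%:R^-1 & y \notin map fst s].
  by move=> j; apply: circle_points; rewrite // invr_gt0.
have y1 j : normc (y j) = 1 by have [] := yP j.
have yle j : normc (y j) <= 1 by rewrite y1.
have ycvg : ccvg y lam1 by apply: ccvg_dist => j; have [] := yP j.
have l1' : normc lam1 <= 1 by rewrite l1.
have high j : exists L, n%:R - 1 / 2 < dirichlet (alpha (y j)) L.
  have [g [sg g1 _ g_zero phiE]] := blaschke _ (y1 j).
  rewrite -sg; apply: (blaschke_dirichlet_ge (alpha_ser _ (yle j)) g1 phiE).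
  move=> gam gamg; rewrite lt_neqAle g1 // andbT; apply/eqP => gam1.
  have [_ _ /negP] := yP j; apply; apply/mapP; exists (y j, gam^-1) => //.
  by apply: in_s; rewrite ?normcV ?gam1 ?invr1 // g_zero.
have dcvg : (fun j => dirichlet (alpha (y j)) L0) @ \oo --> dirichlet (alpha lam1) L0.
  rewrite dirE (_ : (fun j => _) =
    fun j => \sum_(0 <= l < L0) l%:R * normc (alpha (y j) l) ^+ 2); last first.
    by apply/funext => j; rewrite dirE.
  apply: cvg_sumr => l; apply: cvgM; first exact: cvg_cst.
  exact: ccvg_normc_sq (cvg_alpha _ _ l1' yle ycvg l).
have e4 : 0 < 1 / 4 :> R by lra.
have /cvgrPdist_le/(_ _ e4)[j _ /(_ j (leqnn j)) /=] := dcvg.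
rewrite ler_norml => /andP[close _].
(* The bounds chain to n - 1/2 < (n - 1) + 1/4 + 1/8, where 1/4 comes from convergence of the first
   [L0] terms and 1/8 from the tail. *)
have [L hL] := high j.
have := dir_tail (y j) L (yle j); have := low L0; lra.
Qed.
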